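(* (a) Fix integers $\Delta\ge 1$ and $q\ge \Delta+2$. There is a constant $C>0$, depending only on $q$ and $\Delta$, such that for every integer $t\ge1$ and every graph $G$ with $n\ge 2$ vertices, maximum degree at most $\Delta$ and treewidth at most $t$, the (unbiased) Glauber dynamics on the proper $q$-colorings of $G$ has mixing time $\tau(1/4)\le n^{Ct}$. (b) Fix a real $\lambda>0$ and an integer $q$. There is a constant $C>0$, depending only on $q$ and $\lambda$, such that for every integer $t\ge 1$ and every graph $G$ with $n\ge 2$ vertices, treewidth at most $t$ and maximum degree $\Delta$ satisfying $q\ge\Delta+2$, the Glauber dynamics on the partial $q$-colorings of $G$ with parameter $\lambda$ has mixing time $\tau(1/4)\le n^{Ct}$.
   Context: A (proper) $q$-coloring of $G$ assigns to each vertex a color in $[q]=\{1,\dots,q\}$ so that adjacent vertices receive different colors. A partial $q$-coloring assigns colors from $[q]$ to a subset of the vertices so that no two adjacent colored vertices receive the same color. The Glauber dynamics on $q$-colorings: start at an arbitrary $q$-coloring $X_0$; at each step choose a vertex $v$ uniformly at random and a color $c\in[q]$ different from the current color of $v$ uniformly at random; if $v$ has no neighbor colored $c$, recolor $v$ with $c$ with probability $1/2$; otherwise do nothing. The Glauber dynamics on partial $q$-colorings with parameter $\lambda>0$: start at an arbitrary partial $q$-coloring $X_0$; at each step choose $v\in V(G)$ uniformly at random and $c\in[q+1]$ uniformly at random; if $c=q+1$ and $v$ is colored, uncolor $v$ with probability $1/(\lambda+1)$ (otherwise keep $X_t$); if $c\le q$ and $v$ is not already colored $c$, set the color of $v$ to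 $c$ with probability $\lambda/(\lambda+1)$, provided the result is a valid partial $q$-coloring (otherwise keep $X_t$). Its stationary distribution gives a partial coloring with $k$ colored vertices weight proportional to $\lambda^{k}$. The mixing time $\tau(\varepsilon)$ is the minimum time $t$ such that from every starting state the total variation distance $\frac12\sum_{S}|\pi_t(S)-\pi^*(S)|$ between the time-$t$ distribution and the stationary distribution $\pi^*$ is less than $\varepsilon$. *)

(* Defs.v *)
From mathcomp Require Import all_boot all_order all_algebra.
From mathcomp Require Import reals exp.

Set Implicit Arguments.
Unset Strict Implicit.
Unset Printing Implicit Defensive.

Import Order.TTheory GRing.Theory Num.Theory.

Local Open Scope ring_scope.

Record sgraph := SGraph {
  svertex :> finType;
  sedge : rel svertex;
  sedge_sym : symmetric sedge;
  sedge_irrefl : irreflexive sedge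
}.

Definition degree (G : sgraph) (v : G) : nat := #|[set u | sedge v u]|.

Definition max_degree (G : sgraph) : nat := (\max_(v : G) degree v)%N.

Definition is_tree (F : sgraph) : Prop :=
  [/\ (0 < #|F|)%N,
      forall i j : F, connect (@sedge F) i j
    & forall s : seq F, (2 < size s)%N -> ~~ ucycleb (@sedge F) s].

(* The last condition says that the tree nodes whose bag contains v induce a
   connected subgraph of the tree. *)
Definition tree_decomposition (G F : sgraph) (B : F -> {set G}) : Prop :=
  [/\ is_tree F,
      forall v : G, exists i, v \in B i,
      forall u v : G, sedge u v -> exists i, (u \in B i) && (v \in B i)
    & forall (v : G) (i j : F), v \in B i -> v \in B j ->
        connect [rel k l | [&& sedge k l, v \in B k & v \in B l]] i j].

(* The width of a decomposition is the largest bag size minus one. *)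
Definition treewidth_le (G : sgraph) (t : nat) : Prop :=
  exists (F : sgraph) (B : F -> {set G}),
    tree_decomposition B /\ forall i, (#|B i| <= t.+1)%N.

(* A chain on the finite state space S is given by its transition
   probabilities: P x y is the probability of moving from x to y. *)
Section MarkovChain.
Variables (R : realType) (S : finType).
Implicit Types (P : S -> S -> R) (mu nu : {ffun S -> R}).

Definition is_distribution mu : Prop :=
  (forall x, 0 <= mu x) /\ \sum_x mu x = 1.

Definition evolve P mu : {ffun S -> R} := [ffun y => \sum_x mu x * P x y].

Definition stationary P mu : Prop := is_distribution mu /\ evolve P mu = mu.

Definition dist_at P (x : S) (t : nat) : {ffun S -> R} :=
  iter t (evolve P) [ffun y => (y == x)%:R].

Definition tv_dist mu nu : R := 2^-1 * \sum_x `|mu x - nu x|.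

Definition mixed_at P nu (eps : R) (t : nat) : Prop :=
  forall x, tv_dist (dist_at P x t) nu < eps.

(* tau is the mixing time tau(eps) of P; that "the" stationary distribution
   exists and is unique, and that tau(eps) is finite, is part of the
   assertion. *)
Definition is_mixing_time P (eps : R) (tau : nat) : Prop :=
  exists nu, [/\ unique (stationary P) nu, mixed_at P nu eps tau
    & forall s, mixed_at P nu eps s -> (tau <= s)%N].

End MarkovChain.

Definition recolor (T : finType) (A : Type) (x : {ffun T -> A}) (v : T) (c : A)
  : {ffun T -> A} := [ffun u => if u == v then c else x u].

Definition is_proper (G : sgraph) (q : nat) (x : {ffun G -> 'I_q}) : bool :=
  [forall u, forall v, sedge u v ==> (x u != x v)].

Definition coloring (G : sgraph) (q : nat) : finType :=
  {x : {ffun G -> 'I_q} | is_proper x}.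

(* Law of the next state, given that vertex v and color c were chosen. *)
Definition glauber_move (R : realType) (G : sgraph) (q : nat)
    (x : coloring G q) (v : G) (c : 'I_q) (y : coloring G q) : R :=
  if [forall u, sedge v u ==> (val x u != c)]
  then 2^-1 * (val y == recolor (val x) v c)%:R + 2^-1 * (y == x)%:R
  else (y == x)%:R.

Definition glauber (R : realType) (G : sgraph) (q : nat)
    (x y : coloring G q) : R :=
  \sum_(v : G) #|G|%:R^-1 *
    \sum_(c : 'I_q | c != val x v) (q%:R - 1)^-1 * glauber_move R x v c y.

(* None stands for an uncolored vertex. *)
Definition is_partial_proper (G : sgraph) (q : nat)
    (x : {ffun G -> option 'I_q}) : bool :=
  [forall u, forall v,
    [&& sedge u v, isSome (x u) & isSome (x v)] ==> (x u != x v)].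

Definition partial_coloring (G : sgraph) (q : nat) : finType :=
  {x : {ffun G -> option 'I_q} | is_partial_proper x}.

(* Law of the next state, given that vertex v and c in [q+1] were chosen;
   [q+1] is encoded as option 'I_q, with None in the role of q+1. *)
Definition partial_glauber_move (R : realType) (G : sgraph) (q : nat)
    (lambda : R) (x : partial_coloring G q) (v : G) (c : option 'I_q)
    (y : partial_coloring G q) : R :=
  let x' := recolor (val x) v c in
  let p := if c is Some _ then lambda / (lambda + 1) else 1 / (lambda + 1) in
  if (val x v != c) && is_partial_proper x'
  then p * (val y == x')%:R + (1 - p) * (y == x)%:R
  else (y == x)%:R.

Definition partial_glauber (R : realType) (G : sgraph) (q : nat)
    (lambda : R) (x y : partial_coloring G q) : R :=
  \sum_(v : G) #|G|%:R^-1 *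
    \sum_(c : option 'I_q) q.+1%:R^-1 * partial_glauber_move lambda x v c y.

(* Main.v *)
(* Let pi be the stationary law.  The vertices of a graph of treewidth at most t
   can be ordered so that every prefix L has at most (t + 1) log2(2n) vertices
   with a neighbor outside L: put a balanced bag first, then recurse on the
   branches it separates.  To compare two states x and y, walk along this
   ordering, replacing x by y on the prefix L; conflicts occur only at the
   boundary H of L, where the colors are re-chosen.  Consecutive states of the
   walk differ on a block K of O(t log n) vertices, and a block can be changed
   one vertex at a time because each vertex always has a color compatible with
   its neighborhood and with one further prescribed color.  The complementary
   state (x on L, y off L) together with x and y on K determines (x, y), so each
   transition carries a load of at most exp(O(|K|)) = n^O(t).  By Cauchy-Schwarz this is a
   Poincare inequality with constant n^O(t); as the chain stays put with
   probability bounded below, the variance of the density contracts by a factor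
   1 - n^(-O(t)) per step, and log(1 / min pi) = O(n). *)
Require Import Defs.
From mathcomp Require Import all_boot all_order all_algebra.
From mathcomp Require Import reals exp.
From mathcomp Require Import ring lra zify.

Set Implicit Arguments.
Unset Strict Implicit.
Unset Printing Implicit Defensive.

Import Order.TTheory GRing.Theory Num.Theory.

Local Open Scope ring_scope.

(** * Balanced separators and vertex orderings from tree decompositions *)

Section Separator.
Local Open Scope nat_scope.
Variables (G F : sgraph) (B : F -> {set G}).
Hypothesis tdB : tree_decomposition B.

(** Adjacency in the tree with node [i] deleted. Keeping [i] as an isolated node saves a change of
    node type; the components of the other nodes are the branches at [i]. *)
Definition avoid (i : F) : rel F := [rel k l | [&& sedge k l, k != i & l != i]].

Lemma avoid_sym i : connect_sym (avoid i).
Proof.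
by apply: sym_connect_sym => k l; rewrite /avoid /= sedge_sym; congr (_ && _); rewrite andbC.
Qed.

Lemma connect_avoid_neq i j k : connect (avoid i) j k -> j != i -> k != i.
Proof.
move=> /connectP [p]; elim: p j => [|l p IHp] j /= => [_ -> //|].
by move=> /andP [/and3P [_ _ li] pl] kE _; apply: IHp kE li.
Qed.

(** Two neighbors of [i] in one branch would be joined by a simple path missing [i], which closes up
    to a cycle through [i]. *)
Lemma branch_neighbor_unique i j k :
  sedge i j -> sedge i k -> connect (avoid i) j k -> j = k.
Proof.
move=> ij ik /connectP [p0 /shortenP [p pp up _] kE].
case: (eqVneq j k) => // jk; exfalso.
have [_ _ acyc] : is_tree F by case: tdB.
have ji : j != i by apply: contraTneq ij => ->; rewrite sedge_irrefl.
have ip : i \notin p.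
  elim: p j pp ji {up kE ij jk} => //= l p IHp j /andP [/and3P [_ _ li] pl] _.
  by rewrite inE negb_or eq_sym li; apply: IHp pl li.
have sp : path (@sedge F) j p by apply: sub_path pp => x y /and3P [].
have szp : 2 < size [:: i, j & p].
  by case: p kE {pp up ip sp} => // kE; rewrite kE eqxx in jk.
apply: (negP (acyc _ szp)).
rewrite /ucycleb cons_uniq up /= ij rcons_path sp -kE sedge_sym ik inE negb_or.
rewrite eq_sym ji.
by rewrite ip.
Qed.

Lemma neighbor_toward i j : i != j -> exists2 k, sedge i k & connect (avoid i) k j.
Proof.
move=> ij; have [_ conn _] : is_tree F by case: tdB.
have /connectP [p0 /shortenP [p pp up _] jE] := conn i j.
case: p pp up jE => [|k p] /=; first by move=> _ _ jE; rewrite jE eqxx in ij.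
move=> /andP [ik pk] /andP []; rewrite inE negb_or => /andP [ki ip] _ jE.
exists k => //; apply/connectP; exists p => //.
elim: p k pk ki ip {ik jE} => //= l p IHp k /andP [kl pl] ki.
rewrite inE negb_or => /andP [il ip].
apply/andP; split; last exact: IHp.
by rewrite /avoid /= kl eq_sym ki eq_sym il.
Qed.

Lemma home_proof (v : G) : exists i, v \in B i.
Proof. by case: tdB. Qed.

(** An arbitrary node whose bag contains [v]. If [v] is not in the bag of [i], all such nodes lie in
    one branch at [i] ([connect_home]), so [branch i v] does not depend on the choice. *)
Definition home v := xchoose (home_proof v).

Definition branch (i : F) v := fingraph.root (avoid i) (home v).

Lemma connect_home i v k : v \notin B i -> v \in B k -> connect (avoid i) (home v) k.
Proof.
move=> vi vk; have [_ _ _ conn] := tdB.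
apply: connect_sub (conn v _ _ (xchooseP (home_proof v)) vk) => x y /and3P [xy vx vy].
apply: connect1; rewrite /avoid /= xy /=.
by apply/andP; split; apply: contraNneq vi => <-.
Qed.

Lemma home_neq i v : v \notin B i -> home v != i.
Proof. by apply: contraNneq => <-; exact: (xchooseP (home_proof v)). Qed.

(** Some bag contains both endpoints, and its node lies in the branch of each of them. *)
Lemma branch_edge i u v :
  sedge u v -> u \notin B i -> v \notin B i -> branch i u = branch i v.
Proof.
move=> uv ui vi; have [_ _ /(_ _ _ uv) [k /andP [uk vk]] _] := tdB.
apply/(fingraph.rootP (avoid_sym i)); apply: connect_trans (connect_home ui uk) _.
by rewrite avoid_sym; apply: connect_home.
Qed.

Definition branch_set (U : {set G}) i c := [set v in U | (v \notin B i) && (branch i v == c)].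

(* Walking from a tree node into a branch carrying more than half of U strictly
   shrinks the heavy branch, so the walk stops at a centroid. *)
Lemma balanced_separator (U : {set G}) :
  exists i, forall c, #|branch_set U i c|.*2 <= #|U|.
Proof.
have [[F0 _ _] _ _ _] := tdB.
pose good i := [forall c, #|branch_set U i c|.*2 <= #|U|].
suff [i /forallP gi] : exists i, good i by exists i.
have notgood i : ~~ good i -> exists c, #|U| < #|branch_set U i c|.*2.
  by rewrite negb_forall => /existsP [c]; rewrite -ltnNge; exists c.
case/card_gt0P: F0 => i0 _.
have [?|/notgood [c hc]] := boolP (good i0); first by exists i0.
(* The measure is the number of tree nodes in the heavy component. *)
have [m] := ubnP #|[set k | connect (avoid i0) c k]|.
elim: m i0 c hc => // m IHm i c hc; rewrite ltnS => szc.
have /card_gt0P [v] : 0 < #|branch_set U i c| by case: #|branch_set U i c| hc.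
rewrite !inE => /and3P [vU vi /eqP bv].
have [j ij jv] : exists2 k, sedge i k & connect (avoid i) k (home v).
  by apply: neighbor_toward; rewrite eq_sym home_neq.
have [?|/notgood [c' hc']] := boolP (good j); first by exists j.
have cv : connect (avoid i) (home v) c by rewrite -bv connect_root.
have ji : j != i by apply: contraTneq ij => ->; rewrite sedge_irrefl.
(* Two subsets of [U], each with more than half of its elements, must meet. *)
have /set0Pn [u] : branch_set U i c :&: branch_set U j c' != set0.
  apply: contraTneq hc' => dis; rewrite -leqNgt.
  have := cardsUI (branch_set U i c) (branch_set U j c'); rewrite dis cards0.
  have : #|branch_set U i c :|: branch_set U j c'| <= #|U|.
    by apply/subset_leq_card/subsetP => x; rewrite !inE => /orP [] /and3P [].
  lia.
rewrite !inE => /andP [/and3P [_ ui /eqP bu] /and3P [_ uj /eqP bu']].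
have sub : [set k | connect (avoid j) c' k] \subset
           [set k | connect (avoid i) c k] :\ j.
  (* An edge leaving the component would have to enter [i], but the only neighbor of [i] inside the
     component is [j], which is deleted. *)
  have cl : closed (avoid j) [set k | connect (avoid i) c k].
    apply: intro_closed; first exact: avoid_sym.
    move=> k l /and3P [kl kj lj]; rewrite !inE => ck.
    have jk : connect (avoid i) j k.
      by apply: connect_trans jv (connect_trans cv ck).
    have ki := connect_avoid_neq jk ji.
    have [li|li] := eqVneq l i.
      by rewrite (branch_neighbor_unique ij _ jk) ?eqxx // sedge_sym -li in kj.
    by apply: connect_trans ck (connect1 _); rewrite /avoid /= kl ki.
  apply/subsetP => k; rewrite inE => ck.
  have uk : connect (avoid j) (home u) k.
    by apply: connect_trans ck; rewrite -bu' connect_root.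
  rewrite in_setD1 (connect_avoid_neq uk) ?home_neq // -(closed_connect cl uk).
  by rewrite inE -bu avoid_sym connect_root.
apply: (IHm j c' hc'); apply: leq_ltn_trans (subset_leq_card sub) _.
have : j \in [set k | connect (avoid i) c k].
  by rewrite inE avoid_sym; apply: connect_trans jv cv.
by move=> jc; move: szc; rewrite (cardsD1 j) jc.
Qed.
End Separator.

(** * Vertex orderings with small prefix boundaries *)

Section Layout.
Local Open Scope nat_scope.
Variable G : sgraph.
Implicit Types (U L : {set G}).

Definition boundary U L := [set v in L | [exists u, sedge v u && (u \in U :\: L)]].

(** In graph terms: the subgraph induced on [U] has vertex separation number, equivalently
    pathwidth, at most [k]. *)
Definition layout U k := exists s : seq G,
  [/\ uniq s, s =i U & forall m, #|boundary U [set x in take m s]| <= k].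

Lemma boundaryP U L v :
  reflect (v \in L /\ exists u, [/\ sedge v u, u \in U & u \notin L]) (v \in boundary U L).
Proof.
rewrite inE; apply: (iffP andP) => [[vL /existsP [u]]|[vL [u [vu uU uL]]]].
  by rewrite in_setD => /and3P [vu uL uU]; split=> //; exists u.
by split=> //; apply/existsP; exists u; rewrite in_setD vu uU uL.
Qed.

Lemma layout0 k : layout set0 k.
Proof.
exists [::]; split=> // [x|m]; first by rewrite inE.
rewrite (_ : boundary _ _ = set0) ?cards0 //.
by apply/setP => v; rewrite !inE.
Qed.

(** The two orderings are concatenated. Without edges between the sets, [U1] never sees [U2] outside
    a prefix, so at each moment only one of the two boundaries counts. *)
Lemma layoutU U1 U2 k :
    [disjoint U1 & U2] -> (forall u v, u \in U1 -> v \in U2 -> ~~ sedge u v) ->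
  layout U1 k -> layout U2 k -> layout (U1 :|: U2) k.
Proof.
move=> dis noedge [s1 [us1 s1U b1]] [s2 [us2 s2U b2]]; exists (s1 ++ s2).
have U12 x : x \in U1 -> x \in U2 -> false by move=> x1; rewrite (disjointFr dis x1).
split=> [|x|m].
- rewrite cat_uniq us1 us2 andbT; apply/hasPn => x; rewrite s2U => x2.
  by apply/negP; rewrite s1U => x1; have := U12 _ x1 x2.
- by rewrite mem_cat inE s1U s2U.
rewrite take_cat; case: ifP => ms.
  apply: leq_trans (b1 m); apply/subset_leq_card/subsetP => v.
  case/boundaryP => vL [u [vu uU uL]]; apply/boundaryP; split=> //; exists u.
  split=> //; move: uU; rewrite inE => /orP [//|u2].
  have v1 : v \in U1 by move: vL; rewrite inE => /mem_take; rewrite s1U.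
  by rewrite (negPf (noedge _ _ v1 u2)) in vu.
apply: leq_trans (b2 (m - size s1)); apply/subset_leq_card/subsetP => v.
case/boundaryP => vL [u [vu uU uL]]; apply/boundaryP.
move: uL; rewrite inE mem_cat negb_or s1U => /andP [u1 uL].
have u2 : u \in U2 by move: uU; rewrite inE (negPf u1).
move: vL; rewrite inE mem_cat s1U => /orP [v1|vL].
  by rewrite (negPf (noedge _ _ v1 u2)) in vu.
by split; [rewrite inE|exists u; rewrite inE].
Qed.

(** The vertices of [L] are put first; a boundary vertex of a prefix is then in [L] or in the
    boundary of the corresponding prefix of the rest. *)
Lemma layoutD U L k : layout (U :\: L) k -> layout U (k + #|L|).
Proof.
move=> [s [us sU b]]; exists (enum (U :&: L) ++ s).
split=> [|x|m].
- rewrite cat_uniq us enum_uniq andbT; apply/hasPn => x; rewrite sU inE => /andP [xL _].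
  by rewrite mem_enum inE (negPf xL) andbF.
- by rewrite mem_cat mem_enum sU !inE; case: (x \in U); case: (x \in L).
apply: leq_trans (_ : #|boundary (U :\: L) [set x in take (m - size (enum (U :&: L))) s] :|: L| <= _);
  last first.
  by apply: leq_trans (leq_card_setU _ _) _; rewrite leq_add2r.
apply/subset_leq_card/subsetP => v /boundaryP [vP [u [vu uU uP]]].
rewrite in_setU; case: (boolP (v \in L)) => vL; rewrite ?orbT // orbF.
apply/boundaryP; move: vP uP; rewrite !inE take_cat; case: ifP => _.
  by move=> /mem_take; rewrite mem_enum inE (negPf vL) andbF.
rewrite !mem_cat !mem_enum !inE (negPf vL) andbF /= => vP.
rewrite negb_or uU => /= /andP [uL uP].
by rewrite vP; split=> //; exists u; rewrite !inE uU uL.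
Qed.

(** Induction on [m]: a balanced bag costs at most t + 1 vertices and goes first, and the branches
    it leaves have at most half of the vertices and no edges between them. *)
Lemma layout_treewidth t m U :
  treewidth_le G t -> #|U| < 2 ^ m -> layout U (t.+1 * m).
Proof.
move=> [F [B [tdB szB]]]; elim: m U => [|m IHm] U.
  by rewrite ltnS leqn0 cards_eq0 => /eqP ->; apply: layout0.
move=> Um; have [i bal] := balanced_separator tdB U.
have {}IHm c : layout (branch_set tdB U i c) (t.+1 * m).
  by apply: IHm; have := bal c; rewrite expnS in Um; lia.
(* Branches are joined one at a time along a list of candidate representatives; the list is finally
   [enum F], where nodes representing no branch contribute the empty set. *)
have step (cs : seq F) : layout [set v in U :\: B i | branch tdB i v \in cs] (t.+1 * m).
  elim: cs => [|c cs IHcs].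
    rewrite (_ : [set _ in _ | _] = set0); first exact: layout0.
    by apply/setP => v; rewrite !inE andbF.
  case: (boolP (c \in cs)) => ccs.
    rewrite (_ : [set _ in _ | _] = [set v in U :\: B i | branch tdB i v \in cs]) //.
    by apply/setP => v; rewrite !inE; case: eqP => // ->; rewrite ccs.
  rewrite (_ : [set _ in _ | _] =
      branch_set tdB U i c :|: [set v in U :\: B i | branch tdB i v \in cs]); last first.
    apply/setP => v; rewrite !inE.
    by case: (v \in B i); case: (v \in U) => //=.
  apply: layoutU => //.
    rewrite -setI_eq0; apply/eqP/setP => v; rewrite !inE; apply/negP.
    by move=> /andP [/and3P [_ _ /eqP ->]]; rewrite (negPf ccs) andbF.
  move=> u v; rewrite !inE => /and3P [_ ui /eqP bu] /andP [/andP [vi _] bv].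
  by apply: contra ccs => uv; rewrite -bu (branch_edge tdB uv).
rewrite mulnS addnC.
have : layout U (t.+1 * m + #|B i|).
  apply: layoutD; have := step (enum F).
  rewrite (_ : [set _ in _ | _] = U :\: B i) //.
  by apply/setP => v; rewrite inE mem_enum andbT.
move=> [s' [us sU b]]; exists s'; split=> // m'.
by apply: leq_trans (b m') _; rewrite leq_add2l.
Qed.

End Layout.

(** * Single-site connectivity of spin configurations *)

Section SpinSystem.
Variables (G : sgraph) (A : finType) (compat : rel A).
Implicit Types (U H L K : {set G}) (x y z : {ffun G -> A}) (v u : G).

(** Restricting the constraints to [U] lets the inductions below release vertices one at a time. *)
Definition compatible_on U x := [forall u, forall v,
  [&& sedge u v, u \in U & v \in U] ==> compat (x u) (x v)].

Lemma compatible_onP U x :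
  reflect (forall u v, sedge u v -> u \in U -> v \in U -> compat (x u) (x v))
          (compatible_on U x).
Proof.
apply: (iffP forallP) => [h u v uv uU vU|h u].
  by have /forallP/(_ v) := h u; rewrite uv uU vU.
by apply/forallP => v; apply/implyP => /and3P []; apply: h.
Qed.

Definition agree_off H x y := [forall u, (u \notin H) ==> (x u == y u)].

Lemma agree_offP H x y :
  reflect (forall u, u \notin H -> x u = y u) (agree_off H x y).
Proof.
apply: (iffP forallP) => [h u uH|h u]; first by apply/eqP; exact: (implyP (h u)).
by apply/implyP => /h ->.
Qed.

Lemma agree_offC H x y : agree_off H x y = agree_off H y x.
Proof. by apply: eq_forallb => u; rewrite eq_sym. Qed.

Lemma agree_off_trans H x y z : agree_off H x y -> agree_off H y z -> agree_off H x z.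
Proof.
by move=> /agree_offP xy /agree_offP yz; apply/agree_offP => u uH; rewrite xy // yz.
Qed.

Lemma agree_offS H K x y : H \subset K -> agree_off H x y -> agree_off K x y.
Proof.
move=> /subsetP HK /agree_offP xy; apply/agree_offP => u uK.
by apply: xy; apply: contra uK; apply: HK.
Qed.

Lemma agree_off_recolor x v c : agree_off [set v] x (recolor x v c).
Proof. by apply/agree_offP => u; rewrite inE ffunE => /negPf ->. Qed.

Lemma card_agree_off H x : #|[pred y | agree_off H x y]| = (#|A| ^ #|H|)%N.
Proof.
rewrite (@eq_card _ _ (mem (family (fun u => if u \in H then predT else pred1 (x u))))).
  rewrite card_family foldrE big_map big_enum /=.
  rewrite -(prod_nat_const (mem H)) [RHS]big_mkcond /=; apply: eq_bigr => u _.
  by case: ifP => _; rewrite ?card1.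
move=> y; rewrite inE; apply/agree_offP/familyP => xy u.
  by case: ifP => // /negbT /xy ->; rewrite inE.
by move=> uH; have := xy u; rewrite (negPf uH) inE => /eqP.
Qed.

Hypothesis compat_sym : symmetric compat.
(** For proper colorings this is the condition that [q] is at least the maximum degree plus 2; for
    partial colorings [d] can be the uncolored state. *)
Hypothesis free_color : forall v x c,
  exists2 d, compat d c & forall u, sedge v u -> compat d (x u).

Lemma compatible_on_recolor U x v d :
    compatible_on (U :\ v) x -> (forall u, sedge v u -> compat d (x u)) ->
  compatible_on U (recolor x v d).
Proof.
move=> /compatible_onP ox vd; apply/compatible_onP => u w uw uU wU; rewrite !ffunE.
have [uv|uv] := eqVneq u v; have [wv|wv] := eqVneq w v.
- by rewrite uv wv sedge_irrefl in uw.
- by apply: vd; rewrite -uv.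
- by rewrite compat_sym; apply: vd; rewrite -wv sedge_sym.
by apply: ox; rewrite ?in_setD1 ?uv ?wv.
Qed.

Lemma compatible_onS U K x : U \subset K -> compatible_on K x -> compatible_on U x.
Proof.
move=> /subsetP UK /compatible_onP ox; apply/compatible_onP => u v uv /UK uK /UK vK.
exact: ox.
Qed.

(** Greedy repair: the vertices of [H] in turn receive a color compatible with all their current
    neighbors. *)
Lemma compatible_extension H x : compatible_on (~: H) x ->
  exists y, compatible_on setT y && agree_off H x y.
Proof.
have [m] := ubnP #|H|; elim: m H x => // m IHm H x; rewrite ltnS => szH ox.
have [H0|/set0Pn [v vH]] := eqVneq H set0.
  by exists x; rewrite H0 setC0 in ox *; rewrite ox; apply/agree_offP.
have [d _ dx] := free_color v x (x v).
have [||y /andP [oy /agree_offP xy]] := IHm (H :\ v) (recolor x v d).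
- by move: szH; rewrite (cardsD1 v) vH.
- apply: compatible_on_recolor => //; apply: compatible_onS ox.
  by apply/subsetP => u; rewrite !inE => /andP [/negPf ->].
exists y; rewrite oy; apply/agree_offP => u uH; rewrite -xy ?ffunE.
  by case: eqP => // uv; rewrite uv vH in uH.
by rewrite in_setD1 (negPf uH) andbF.
Qed.

Definition block_step U H : rel {ffun G -> A} := [rel x y |
  [&& compatible_on U x, compatible_on U y & [exists v in H, agree_off [set v] x y]]].

Lemma block_stepP U H x y v : compatible_on U x -> compatible_on U y -> v \in H ->
  agree_off [set v] x y -> connect (block_step U H) x y.
Proof.
move=> ox oy vH xy; apply: connect1; rewrite /block_step /= ox oy /=.
by apply/existsP; exists v; rewrite vH.
Qed.

(* A step that ignores the vertex v is simulated by first moving v to a color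
   compatible with its neighbors before and after the step. *)
Lemma connect_block_lift U H v z z' : v \in H ->
    connect (block_step (U :\ v) H) z z' -> compatible_on U z ->
  exists w, [/\ connect (block_step U H) z w, compatible_on U w & agree_off [set v] w z'].
Proof.
move=> vH /connectP [p]; elim/last_ind: p z' => [|p z1 IHp] z' /=.
  by move=> _ -> oz; exists z; split=> //; apply/agree_offP.
rewrite rcons_path last_rcons => /andP [pp st] -> oz.
have [w [cw ow /agree_offP wz]] := IHp _ pp (erefl _) oz.
case/and3P: st => _ oz1 /existsP [u /andP [uH /agree_offP lz]].
(* If the simulated step moves only the ignored vertex [v], nothing has to be done. *)
have [uv|uv] := eqVneq u v.
  exists w; split=> //; apply/agree_offP => k kv; rewrite wz //.
  by apply: lz; rewrite uv.
(* [d] suits the neighbors of [v] in [w] and also the color that [u] is about to take, so after [v]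
   moves to [d] the change at [u] is valid. *)
have [d dc dw] := free_color v w (z1 u).
have owd : compatible_on U (recolor w v d).
  by apply: compatible_on_recolor dw; apply: compatible_onS ow; apply: subsetDl.
have wdz k : k != u -> k != v -> recolor w v d k = z1 k.
  by move=> ku kv; rewrite ffunE (negPf kv) wz ?inE // lz ?inE.
have z1E : recolor (recolor w v d) u (z1 u) = recolor z1 v d.
  apply/ffunP => k; rewrite ffunE [RHS]ffunE.
  have [ku|ku] := eqVneq k u; have [kv|kv] := eqVneq k v => //.
  - by rewrite -ku kv eqxx in uv.
  - by rewrite ku.
  - by rewrite ffunE kv eqxx.
  - by rewrite wdz.
have oz1d : compatible_on U (recolor z1 v d).
  apply: compatible_on_recolor => // k vk; have [->//|ku] := eqVneq k u.
  have kv : k != v by apply: contraTneq vk => ->; rewrite sedge_irrefl.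
  by rewrite -wdz // ffunE (negPf kv); apply: dw.
exists (recolor z1 v d); split=> //; last by rewrite agree_offC agree_off_recolor.
apply: connect_trans cw _; apply: connect_trans (block_stepP ow owd vH _) _.
  exact: agree_off_recolor.
apply: (block_stepP owd oz1d uH); rewrite -z1E.
exact: agree_off_recolor.
Qed.

(** Induction on the number of vertices of [H] still constrained by [U]. One such vertex [v] is
    released, the path for [U :\ v] is lifted, and a last step gives [v] its color in [y]; this is
    valid since the rest of [U] already agrees with [y]. *)
Lemma connect_block_on U H x y : ~: H \subset U ->
    compatible_on U x -> compatible_on U y -> agree_off H x y ->
  exists w, [/\ connect (block_step U H) x w, compatible_on U w & agree_off (~: U) w y].
Proof.
have [m] := ubnP #|U :&: H|; elim: m U => // m IHm U; rewrite ltnS => szm HU ox oy xy.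
have [UH0|/set0Pn [v]] := eqVneq (U :&: H) set0.
  exists x; split=> //; apply: agree_offS xy; apply/subsetP => u uH.
  by rewrite inE; apply/negP => uU; have := in_set0 u; rewrite -UH0 inE uU uH.
rewrite inE => /andP [vU vH].
have [|||||w' [cw' ow' /agree_offP wy']] := IHm (U :\ v).
- move: szm; rewrite (cardsD1 v) inE vU vH /=.
  by rewrite (_ : (U :\ v) :&: H = (U :&: H) :\ v) ?setIDAC.
- apply/subsetP => u uH; rewrite in_setD1 (subsetP HU) // andbT.
  by apply: contraTneq uH => ->; rewrite inE vH.
- by apply: compatible_onS ox; apply: subsetDl.
- by apply: compatible_onS oy; apply: subsetDl.
- exact: xy.
have [w [cw ow /agree_offP wy]] := connect_block_lift vH cw' ox.
have wyE u : u \in U -> u != v -> w u = y u.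
  by move=> uU uv; rewrite wy ?inE // wy' // !inE uv uU.
have oyw : compatible_on U (recolor w v (y v)).
  apply/compatible_onP => a b ab aU bU; move/compatible_onP: oy => /(_ a b ab aU bU).
  rewrite !ffunE.
  case: (eqVneq a v) => av; case: (eqVneq b v) => bv; rewrite ?wyE //.
  - by rewrite av bv.
  - by rewrite av.
  - by rewrite bv.
exists (recolor w v (y v)); split=> //.
  by apply: connect_trans cw _; apply: block_stepP vH _ => //; apply: agree_off_recolor.
apply/agree_offP => u; rewrite inE negbK => uU; rewrite ffunE.
by case: eqVneq => [->//|uv]; rewrite wyE.
Qed.

Lemma connect_block H x y :
    compatible_on setT x -> compatible_on setT y -> agree_off H x y ->
  connect (block_step setT H) x y.
Proof.
move=> ox oy xy; have [w [cw _ /agree_offP wy]] := connect_block_on (subsetT _) ox oy xy.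
by rewrite (_ : y = w) //; apply/ffunP => u; rewrite wy // !inE.
Qed.

Lemma connect_block_agree U H x y : connect (block_step U H) x y -> agree_off H x y.
Proof.
move=> /connectP [p]; elim: p x => [|z p IHp] x /= => [_ ->|]; first exact/agree_offP.
move=> /andP [/and3P [_ _ /existsP [v /andP [vH xz]]] pp] yE.
apply: agree_off_trans (IHp _ pp yE); apply: agree_offS xz.
by rewrite sub1set.
Qed.

Lemma connect_block_compatible U H x y :
  connect (block_step U H) x y -> compatible_on U x -> compatible_on U y.
Proof.
move=> /connectP [p]; elim: p x => [|z p IHp] x /= => [_ ->//|].
by move=> /andP [/and3P [_ oz _] pp] yE _; apply: IHp yE oz.
Qed.

End SpinSystem.

(** * Lazy reversible chains with a spectral gap *)

Section Energy.
Variable R : realFieldType.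

(** The sum of p (g - c)^2 is a nonnegative quadratic in c, and its value at c = T / s gives the
    claim. *)
Lemma weighted_cauchy_schwarz (I : Type) (r : seq I) (P : pred I) (p g : I -> R) :
    (forall i, P i -> 0 <= p i) ->
  (\sum_(i <- r | P i) p i * g i) ^+ 2 <=
    (\sum_(i <- r | P i) p i) * \sum_(i <- r | P i) p i * g i ^+ 2.
Proof.
move=> p0; set T := \sum_(i <- r | P i) p i * g i; set s := \sum_(i <- r | P i) p i.
set Q := \sum_(i <- r | P i) p i * g i ^+ 2.
have quad c : 0 <= Q - 2 * c * T + c ^+ 2 * s.
  have : 0 <= \sum_(i <- r | P i) p i * (g i - c) ^+ 2.
    by apply: sumr_ge0 => i Pi; rewrite mulr_ge0 ?p0 ?sqr_ge0.
  rewrite (eq_bigr (fun i => p i * g i ^+ 2 - 2 * c * (p i * g i) + c ^+ 2 * p i)).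
    by rewrite big_split sumrB -!mulr_sumr.
  by move=> i _; ring.
have s0 : 0 <= s by apply: sumr_ge0.
have [s00|sN0] := eqVneq s 0.
  have [->|T0] := eqVneq T 0; first by rewrite expr0n s00 mul0r.
  (* With total weight 0 the quadratic is affine in c, and this choice would give it the value
     -1. *)
  have := quad ((Q + 1) / (2 * T)); rewrite s00 mulr0 addr0.
  by rewrite (_ : 2 * _ * T = Q + 1); [lra|field].
have := quad (T / s); rewrite (_ : _ - _ + _ = (s * Q - T ^+ 2) / s); last by field.
by rewrite pmulr_lge0 ?invr_gt0 ?lt_neqAle 1?eq_sym ?sN0 // subr_ge0.
Qed.

Lemma sumr_sq_le (I : Type) (r : seq I) (P : pred I) (g : I -> R) :
  (\sum_(i <- r | P i) g i) ^+ 2 <= (\sum_(i <- r | P i) 1) * \sum_(i <- r | P i) g i ^+ 2.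
Proof.
have := @weighted_cauchy_schwarz I r P (fun=> 1) g (fun _ _ => ler01).
by under eq_bigr do rewrite mul1r; under [X in _ * X]eq_bigr do rewrite mul1r.
Qed.

(** Cauchy-Schwarz along the path, each squared increment being charged to the state it leaves,
    hence [belast]. *)
Lemma path_energy (T : Type) (e : rel T) (f h : T -> R) a p :
    (forall x y, e x y -> (f x - f y) ^+ 2 <= h x) -> path e a p ->
  (f a - f (last a p)) ^+ 2 <= (size p)%:R * \sum_(z <- belast a p) h z.
Proof.
move=> eh; elim: p a => [|b p IHp] a /=; first by rewrite subrr expr0n mul0r.
move=> /andP [/eh ab /IHp]; rewrite big_cons -natr1.
set D := \sum_(z <- _) h z; set s := (size p)%:R => bl.
have s0 : 0 <= s :> R by rewrite ler0n.
set x := f a - f b in ab *; set y := f b - f _ in bl.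
have -> : f a - f (last b p) = x + y by rewrite /x /y; ring.
have h0 : 0 <= h a by apply: le_trans ab; apply: sqr_ge0.
have [s00|sN0] := eqVneq s 0.
  rewrite s00 mul0r in bl; have -> : y = 0.
    by apply/eqP; rewrite -sqrf_eq0 eq_le bl sqr_ge0.
  have -> : D = 0.
    move/eqP: s00; rewrite pnatr_eq0 => /eqP/size0nil p0.
    by rewrite /D p0 big_nil.
  by rewrite s00 !addr0 add0r mul1r.
have sp : 0 < s by rewrite lt_neqAle eq_sym sN0.
rewrite -(ler_pM2l sp).
(* This square equals s ((s + 1) (x^2 + y^2 / s) - (x + y)^2), which is the inequality that drives
   the induction. *)
have sq : 0 <= (s * x - y) ^+ 2 by apply: sqr_ge0.
have h1 : s * (s + 1) * x ^+ 2 <= s * (s + 1) * h a.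
  by rewrite ler_wpM2l // mulr_ge0 // addr_ge0.
have h2 : (s + 1) * y ^+ 2 <= (s + 1) * (s * D) by rewrite ler_wpM2l // addr_ge0.
nra.
Qed.

(** A simple path visits each state of [D] at most once, so [#|D|] bounds its length and the sum
    over [D] bounds its total charge. *)
Lemma connect_energy (T : finType) (D : {pred T}) (e : rel T) (f h : T -> R) a b :
    (forall x y, e x y -> (f x - f y) ^+ 2 <= h x) -> (forall x, 0 <= h x) ->
    (forall z, connect e a z -> z \in D) -> connect e a b ->
  (f a - f b) ^+ 2 <= #|D|%:R * \sum_(z in D) h z.
Proof.
move=> eh h0 aD /connectP [p0 /shortenP [p pp up _] ->].
apply: le_trans (path_energy eh pp) _.
have ub : uniq (belast a p) by move: up; rewrite lastI rcons_uniq => /andP [].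
have bD z : z \in belast a p -> z \in D.
  move=> /mem_belast za; apply: aD.
  have := path_connect pp za; exact.
apply: ler_pM; rewrite ?ler0n ?sumr_ge0 //.
  rewrite ler_nat -(size_belast a) -(card_uniqP ub); apply: subset_leq_card.
  exact/subsetP.
rewrite big_uniq //= !(big_mkcond (fun z => z \in _)) /=; apply: ler_sum => z _.
by case: ifP => [/bD ->//|_]; case: ifP.
Qed.

End Energy.

(** * Variance decay and mixing time of lazy reversible chains *)

Section Mixing.
Variables (R : realType) (S : finType) (P : S -> S -> R) (pi : {ffun S -> R}) (delta gamma : R).
Hypotheses (P_ge0 : forall x y, 0 <= P x y) (P_sum1 : forall x, \sum_y P x y = 1).
Hypotheses (pi_gt0 : forall x, 0 < pi x) (pi_sum1 : \sum_x pi x = 1).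
Hypothesis reversible : forall x y, pi x * P x y = pi y * P y x.
Hypothesis lazy : forall x, delta <= P x x.
Hypothesis gamma_le1 : gamma <= 1.
(** The double sum is twice the Dirichlet form. With the factor [delta], [gamma] becomes the rate at
    which one step contracts the variance. *)
Hypothesis gap : forall f : S -> R, \sum_x pi x * f x = 0 ->
  gamma * (\sum_x pi x * f x ^+ 2) <=
    delta * \sum_x pi x * \sum_y P x y * (f x - f y) ^+ 2.

Definition act (f : S -> R) x := \sum_y P x y * f y.

(** Jensen with a gain: after subtraction of [f x] the function vanishes at [x], so Cauchy-Schwarz
    involves only the mass 1 - P x x, at most [1 - delta]. *)
Lemma lazy_jensen f x :
  act f x ^+ 2 + delta * \sum_y P x y * (f x - f y) ^+ 2 <= act (fun y => f y ^+ 2) x.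
Proof.
pose g y := f y - f x.
have PxC c : \sum_y P x y * c = c by rewrite -mulr_suml P_sum1 mul1r.
have E1 : act f x = act g x + f x.
  rewrite /act -[X in _ + X]PxC -big_split /=.
  by apply: eq_bigr => y _; rewrite /g; ring.
have E2 : act (fun y => f y ^+ 2) x =
    act (fun y => g y ^+ 2) x + 2 * f x * act g x + f x ^+ 2.
  rewrite /act mulr_sumr -[X in _ + X]PxC -!big_split /=.
  by apply: eq_bigr => y _; rewrite /g; ring.
have -> : \sum_y P x y * (f x - f y) ^+ 2 = act (fun y => g y ^+ 2) x.
  by apply: eq_bigr => y _; rewrite /g; ring.
have cs : act g x ^+ 2 <= (1 - delta) * act (fun y => g y ^+ 2) x.
  have gx : g x = 0 by rewrite /g subrr.
  rewrite /act (bigD1 x) //= [X in _ <= _ * X](bigD1 x) //= gx expr0n /= !mulr0 !add0r.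
  apply: le_trans (weighted_cauchy_schwarz _ _ _) _ => [y _|]; first exact: P_ge0.
  apply: ler_wpM2r; first by apply: sumr_ge0 => y _; rewrite mulr_ge0 ?sqr_ge0.
  by have := P_sum1 x; rewrite (bigD1 x) //=; have := lazy x; lra.
rewrite E1 E2; nra.
Qed.

Lemma stationary_sum f : \sum_x pi x * act f x = \sum_x pi x * f x.
Proof.
under eq_bigr do rewrite /act mulr_sumr.
rewrite exchange_big; apply: eq_bigr => y _ /=.
under eq_bigr do rewrite mulrA reversible -mulrA mulrCA.
by rewrite -mulr_suml P_sum1 mul1r.
Qed.

(** Averaging [lazy_jensen] over [pi] turns its right side into the variance and its [delta] term
    into the form bounded below by [gap]. *)
Lemma variance_contraction f : \sum_x pi x * f x = 0 ->
  \sum_x pi x * act f x ^+ 2 <= (1 - gamma) * \sum_x pi x * f x ^+ 2.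
Proof.
move=> /gap gf; rewrite mulrBl mul1r; apply: le_trans (lerB (lexx _) gf).
rewrite -(stationary_sum (fun x => f x ^+ 2)) mulr_sumr -sumrB.
apply: ler_sum => x _; rewrite [delta * _]mulrCA -mulrBr ler_wpM2l ?(ltW (pi_gt0 _)) //.
by have := lazy_jensen f x; lra.
Qed.

(** The [pi]-mean of its square is the chi-square distance from [mu] to [pi]. *)
Definition density (mu : S -> R) x := mu x / pi x - 1.

(** By reversibility the density evolves under [P] itself rather than under the time-reversed
    kernel. *)
Lemma density_evolve (mu : {ffun S -> R}) x :
  density (evolve P mu) x = act (density mu) x.
Proof.
rewrite /density /act ffunE; under [RHS]eq_bigr do rewrite mulrBr mulr1.
rewrite sumrB P_sum1; congr (_ - _); rewrite mulr_suml; apply: eq_bigr => y _.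
have := reversible x y; have := lt0r_neq0 (pi_gt0 x); have := lt0r_neq0 (pi_gt0 y).
move=> y0 x0 E; apply: (mulfI x0); rewrite [RHS]mulrA E.
by field; rewrite x0 y0.
Qed.

Lemma density_mean (mu : {ffun S -> R}) :
  is_distribution mu -> \sum_x pi x * density mu x = 0.
Proof.
case=> _ mu1; transitivity (\sum_x (mu x - pi x)); last by rewrite sumrB mu1 pi_sum1 subrr.
apply: eq_bigr => x _; rewrite /density mulrBr mulr1 mulrCA divff ?mulr1 //.
exact: lt0r_neq0.
Qed.

Lemma distribution_evolve (mu : {ffun S -> R}) :
  is_distribution mu -> is_distribution (evolve P mu).
Proof.
case=> mu0 mu1; split=> [x|]; first by rewrite ffunE sumr_ge0 // => y _; rewrite mulr_ge0.
under eq_bigr do rewrite ffunE.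
rewrite exchange_big -[RHS]mu1; apply: eq_bigr => x _ /=.
by rewrite -mulr_sumr P_sum1 mulr1.
Qed.

Lemma variance_decay (mu : {ffun S -> R}) t : is_distribution mu ->
  \sum_x pi x * density (iter t (evolve P) mu) x ^+ 2 <=
    (1 - gamma) ^+ t * \sum_x pi x * density mu x ^+ 2.
Proof.
move=> dmu; have dt k : is_distribution (iter k (evolve P) mu).
  by elim: k => //= k; apply: distribution_evolve.
elim: t => [|t IHt]; first by rewrite mul1r.
rewrite iterS exprS -mulrA.
under eq_bigr do rewrite density_evolve.
apply: le_trans (variance_contraction (density_mean (dt t))) _.
by rewrite ler_wpM2l // subr_ge0.
Qed.

Lemma pi_stationary : stationary P pi.
Proof.
split; first by split=> // x; apply: ltW.
apply/ffunP => y; rewrite ffunE; under eq_bigr do rewrite reversible.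
by rewrite -mulr_sumr P_sum1 mulr1.
Qed.

(** The chi-square distance of a stationary law is preserved by a step and also contracted by 1 -
    gamma, so it vanishes. *)
Lemma stationary_unique nu : 0 < gamma -> stationary P nu -> pi = nu.
Proof.
move=> g0 [dnu nuE]; have := variance_decay 1 dnu; rewrite /= nuE expr1.
set V := \sum_x _ => VV.
have V0 : V = 0.
  have Vge : 0 <= V by apply: sumr_ge0 => x _; rewrite mulr_ge0 ?sqr_ge0 ?ltW.
  apply/eqP; rewrite eq_le Vge andbT; nra.
apply/ffunP => x; have /eqP := V0; rewrite psumr_eq0; last first.
  by move=> y _; rewrite mulr_ge0 ?sqr_ge0 ?ltW.
move=> /allP /(_ x (mem_index_enum _)) /=; rewrite mulf_eq0 gt_eqF //= sqrf_eq0.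
rewrite /density subr_eq0 => /eqP h; apply: esym.
by rewrite -[LHS](divfK (lt0r_neq0 (pi_gt0 x))) h mul1r.
Qed.

(** By Cauchy-Schwarz the L1 distance is at most the root of the chi-square distance, here below
    1/2. *)
Lemma tv_dist_small (mu : {ffun S -> R}) :
  \sum_x pi x * density mu x ^+ 2 < 1 / 4 -> tv_dist mu pi < 1 / 4.
Proof.
move=> V4; rewrite /tv_dist.
have -> : \sum_x `|mu x - pi x| = \sum_x pi x * `|density mu x|.
  apply: eq_bigr => x _; rewrite -{2}[pi x]gtr0_norm // -normrM /density mulrBr mulr1.
  by rewrite mulrCA divff ?mulr1 //; apply: lt0r_neq0.
have sV := weighted_cauchy_schwarz (index_enum S) (fun x => `|density mu x|)
  (fun x (_ : predT x) => ltW (pi_gt0 x)).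
rewrite pi_sum1 mul1r [X in _ <= X](eq_bigr (fun x => pi x * density mu x ^+ 2)) in sV;
  last by move=> x _; rewrite real_normK ?num_real.
set s := \sum_x _ in sV *.
have s0 : 0 <= s by apply: sumr_ge0 => x _; rewrite mulr_ge0 // ltW.
nra.
Qed.

Lemma density_point x :
  \sum_y pi y * density [ffun z => (z == x)%:R] y ^+ 2 = (pi x)^-1 - 1.
Proof.
rewrite (eq_bigr (fun y => ((y == x)%:R / pi y - 2 * (y == x)%:R) + pi y)).
  have S1 : \sum_y (y == x)%:R = 1 :> R.
    by rewrite (bigD1 x) //= eqxx big1 ?addr0 // => y /negPf ->.
  rewrite big_split sumrB /= pi_sum1 -mulr_sumr S1 (bigD1 x) //= big1; last first.
    by move=> y /negPf ->; rewrite mul0r.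
  by rewrite eqxx /= mul1r; ring.
move=> y _; rewrite /density ffunE; have := lt0r_neq0 (pi_gt0 y).
by case: (y == x) => p0 /=; field.
Qed.

Lemma mixing_time_le T : 0 < gamma -> (forall x, (1 - gamma) ^+ T / pi x < 1 / 4) ->
  exists tau, is_mixing_time P (1 / 4) tau /\ (tau <= T)%N.
Proof.
move=> g0 hT.
have mixT : mixed_at P pi (1 / 4) T.
  move=> x; apply: tv_dist_small; apply: le_lt_trans (hT x).
  apply: le_trans (variance_decay _ _) _.
    split=> [y|]; first by rewrite ffunE ler0n.
    rewrite (bigD1 x) //= ffunE eqxx big1 ?addr0 // => y /negPf yx.
    by rewrite ffunE yx.
  rewrite density_point ler_wpM2l ?exprn_ge0 ?subr_ge0 //.
  by rewrite gerBl ler01.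
pose mixedb t := [forall x, tv_dist (dist_at P x t) pi < 1 / 4].
have exm : exists t, mixedb t by exists T; apply/forallP.
case: (ex_minnP exm) => tau /forallP mtau min; exists tau; split; last first.
  by apply: min; apply/forallP.
exists pi; split=> //.
  by split; [exact: pi_stationary|move=> nu; apply: stationary_unique].
by move=> s ms; apply: min; apply/forallP.
Qed.

End Mixing.

(** * The Poincare inequality along a vertex ordering *)

Section Poincare.
Variables (R : realFieldType) (G : sgraph) (A : finType) (compat : rel A).
Variables (w : A -> R) (kappa : R).
Hypothesis compat_sym : symmetric compat.
Hypothesis free_color : forall (v : G) (x : {ffun G -> A}) c,
  exists2 d, compat d c & forall u, sedge v u -> compat d (x u).
Hypotheses (kappa_ge1 : 1 <= kappa) (w_bounds : forall a, kappa^-1 <= w a <= kappa).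
Implicit Types (L H K : {set G}) (x y z : {ffun G -> A}) (f : {ffun G -> A} -> R).

Local Notation spin := {ffun G -> A}.
Local Notation valid := (@compatible_on G A compat setT).

Definition weight x : R := \prod_v w (x v).

Definition partition_function : R := \sum_(x : spin | valid x) weight x.

Definition glue L x y : spin := [ffun u => if u \in L then y u else x u].

Definition single_site x y := [exists v, agree_off [set v] x y].

Definition local_energy f x : R :=
  \sum_(y : spin | valid y && single_site x y) (f x - f y) ^+ 2.

(** A fixed but arbitrary repair of [x] on [H]. By [extensionP] the default is not taken for gluings
    of valid states whose seam lies in [H]. *)
Definition extension H x : spin := odflt x [pick y | valid y && agree_off H x y].

Lemma kappa_gt0 : 0 < kappa. Proof. exact: lt_le_trans ltr01 kappa_ge1. Qed.

Lemma w_gt0 a : 0 < w a.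
Proof. by case/andP: (w_bounds a) => h _; apply: lt_le_trans h; rewrite invr_gt0 kappa_gt0. Qed.

Lemma weight_gt0 x : 0 < weight x.
Proof. by apply: prodr_gt0 => v _; apply: w_gt0. Qed.

Lemma local_energy_ge0 f x : 0 <= local_energy f x.
Proof. by apply: sumr_ge0 => y _; apply: sqr_ge0. Qed.

(** An edge between [L] and its complement has its end in [L] on the boundary, hence in [K]; any
    edge off [K] takes both colors from the same state. *)
Lemma glue_compatible L K x y : boundary setT L \subset K -> valid x -> valid y ->
  compatible_on compat (~: K) (glue L x y).
Proof.
move=> /subsetP LK /compatible_onP ox /compatible_onP oy.
apply/compatible_onP => u v uv; rewrite !inE => uK vK; rewrite !ffunE.
case: ifPn => uL; case: ifPn => vL; [exact: oy| | |exact: ox].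
  by case/negP: uK; apply: LK; apply/boundaryP; split=> //; exists v; rewrite inE.
case/negP: vK; apply: LK; apply/boundaryP; split=> //; exists u.
by rewrite inE sedge_sym.
Qed.

Lemma extensionP L K x y : boundary setT L \subset K -> valid x -> valid y ->
  valid (extension K (glue L x y)) && agree_off K (glue L x y) (extension K (glue L x y)).
Proof.
move=> LK ox oy; rewrite /extension; case: pickP => [//|/= none].
have [z oz] := compatible_extension compat_sym free_color (glue_compatible LK ox oy).
by rewrite none in oz.
Qed.

(** Off [K] the pair (z, s) carries the same two colors as (x, y), possibly swapped. At a vertex of
    [K] the product of two weights lies between kappa^-2 and kappa^2, which costs kappa^4. *)
Lemma weight_exchange L K x y z s :
    agree_off K (glue L x y) z -> agree_off K (glue L y x) s ->
  weight x * weight y <= (kappa ^+ 4) ^+ #|K| * (weight z * weight s).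
Proof.
move=> /agree_offP xyz /agree_offP yxs; rewrite /weight.
rewrite -prodr_const [in X in _ <= X]big_mkcond -!big_split /=.
apply: ler_prod => u _.
have [k0 wg] := (kappa_gt0, w_gt0).
apply/andP; split; first by rewrite mulr_ge0 // ltW.
case: ifPn => [_|uK]; last first.
  rewrite mul1r -(xyz u uK) -(yxs u uK) !ffunE.
  by case: ifP => _; rewrite // mulrC.
have ub a b : w a * w b <= kappa ^+ 2.
  rewrite expr2; case/andP: (w_bounds a) (w_bounds b) => _ ha /andP [_ hb].
  by apply: ler_pM => //; apply: ltW.
have lb : (kappa ^+ 2)^-1 <= w (z u) * w (s u).
  rewrite expr2 invfM; case/andP: (w_bounds (z u)) (w_bounds (s u)) => ha _ /andP [hb _].
  by apply: ler_pM => //; rewrite invr_ge0 ltW.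
apply: le_trans (ub _ _) _; rewrite -ler_pdivrMl ?exprn_gt0 //.
apply: le_trans lb; rewrite (_ : _ * _ = (kappa ^+ 2)^-1) //.
by field; rewrite gt_eqF.
Qed.

(* The pair (x, y) is recovered from z, from the state s that is complementary
   to z, and from the values of x and y on K. *)
Lemma congestion L K z : boundary setT L \subset K ->
  \sum_(x : spin | valid x) \sum_(y : spin | valid y && agree_off K (glue L x y) z)
     weight x * weight y
  <= (kappa ^+ 4 * #|A|%:R ^+ 2) ^+ #|K| * (weight z * partition_function).
Proof.
move=> LK; set C := (kappa ^+ 4) ^+ #|K|.
have C0 : 0 <= C by rewrite exprn_ge0 // exprn_ge0 // ltW // kappa_gt0.
have W0 x : 0 <= weight x by apply/ltW/weight_gt0.
(* [b1] and [b2] record that [z] and the complementary state [s] determine [x] and [y] off [K],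
   leaving [#|A| ^ #|K|] choices for each. *)
pose b1 (x s : spin) : R := (agree_off K (glue L z s) x)%:R.
pose b2 (y s : spin) : R := (agree_off K (glue L s z) y)%:R.
pose F x y s := b1 x s * b2 y s * (C * (weight z * weight s)).
have F0 x y s : 0 <= F x y s by rewrite !mulr_ge0.
apply: (@le_trans _ _ (\sum_x \sum_y \sum_(s : spin | valid s) F x y s)).
  rewrite big_mkcond; apply: ler_sum => x _.
  have S0 : 0 <= \sum_y \sum_(s : spin | valid s) F x y s.
    by apply: sumr_ge0 => y _; apply: sumr_ge0.
  case: ifP => // ox; rewrite big_mkcond; apply: ler_sum => y _.
  case: ifP => [/andP [oy xyz]|_]; last exact: sumr_ge0.
  have /andP [os yxs] := extensionP LK oy ox; set s := extension _ _ in os yxs.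
  rewrite (bigD1 s) //= -[X in X <= _]addr0; apply: lerD; last exact: sumr_ge0.
  apply: le_trans (weight_exchange xyz yxs) _; rewrite /F /b1 /b2.
  move/agree_offP: xyz => xyz; move/agree_offP: yxs => yxs.
  have -> : agree_off K (glue L z s) x.
    apply/agree_offP => u uK; rewrite ffunE -xyz // -yxs // !ffunE.
    by case: (u \in L).
  have -> : agree_off K (glue L s z) y.
    apply/agree_offP => u uK; rewrite ffunE -xyz // -yxs // !ffunE.
    by case: (u \in L).
  by rewrite !mul1r.
have cnt x : \sum_y (agree_off K x y)%:R = (#|A|%:R ^+ #|K| : R).
  rewrite -natrX -(card_agree_off K x) -sum1_card natr_sum [RHS]big_mkcond /=.
  by apply: eq_bigr => y _; rewrite inE; case: (agree_off _ _ _).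
under eq_bigr do rewrite exchange_big /=.
rewrite exchange_big /= /partition_function !mulr_sumr; apply: ler_sum => s _.
under eq_bigr do rewrite -mulr_suml -mulr_sumr /b2 cnt.
rewrite -!mulr_suml /b1 cnt exprMn -/C expr2 [(_ * _) ^+ #|K|]exprMn.
by rewrite le_eqVlt; apply/orP/or_introl/eqP; ring.
Qed.

(** A simple path inside [K] joins the two repairs, and its length accounts for one factor
    [#|A| ^ #|K|]. After exchanging the sums, [congestion] pays the other two. *)
Lemma block_energy L K f (a b : spin -> spin -> spin) : boundary setT L \subset K ->
    (forall x y, valid x -> valid y ->
      [/\ valid (a x y), valid (b x y), agree_off K (glue L x y) (a x y)
        & agree_off K (glue L x y) (b x y)]) ->
  \sum_(x : spin | valid x) \sum_(y : spin | valid y)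
     weight x * weight y * (f (a x y) - f (b x y)) ^+ 2
  <= (kappa ^+ 4 * #|A|%:R ^+ 3) ^+ #|K| * partition_function *
     \sum_(z : spin | valid z) weight z * local_energy f z.
Proof.
move=> LK ab; set N : R := #|A|%:R.
have W0 x : 0 <= weight x by apply/ltW/weight_gt0.
have step x y : valid x -> valid y -> (f (a x y) - f (b x y)) ^+ 2 <=
    N ^+ #|K| * \sum_(z : spin | valid z && agree_off K (glue L x y) z) local_energy f z.
  move=> ox oy; have [oa ob xa xb] := ab x y ox oy.
  have cab : connect (block_step compat setT K) (a x y) (b x y).
    apply: connect_block => //; apply: agree_off_trans xb.
    by rewrite agree_offC.
  pose D := [pred z : spin | valid z && agree_off K (glue L x y) z].
  apply: le_trans (connect_energy (D := D) (h := local_energy f) _ _ _ cab) _.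
  - move=> p q /and3P [_ oq /existsP [v /andP [_ pq]]].
    rewrite /local_energy (bigD1 q) /=; last by rewrite oq; apply/existsP; exists v.
    by rewrite lerDl; apply: sumr_ge0 => r _; apply: sqr_ge0.
  - exact: local_energy_ge0.
  - move=> z az; rewrite inE (connect_block_compatible az) //=.
    by apply: agree_off_trans xa (connect_block_agree az).
  apply: ler_wpM2r; first by apply: sumr_ge0 => z _; apply: local_energy_ge0.
  rewrite -natrX ler_nat -(card_agree_off K (glue L x y)); apply: subset_leq_card.
  by apply/subsetP => z; rewrite !inE => /andP [].
apply: (@le_trans _ _ (\sum_(x : spin | valid x) \sum_(y : spin | valid y)
   \sum_(z : spin | valid z) N ^+ #|K| * local_energy f z *
     (if agree_off K (glue L x y) z then weight x * weight y else 0))).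
  apply: ler_sum => x ox; apply: ler_sum => y oy.
  apply: le_trans (ler_wpM2l _ (step x y ox oy)) _; first by rewrite mulr_ge0.
  rewrite big_mkcondr /= !mulr_sumr; apply: ler_sum => z _.
  by case: ifP => _; [rewrite le_eqVlt; apply/orP/or_introl/eqP; ring|rewrite !mulr0].
under eq_bigr do rewrite exchange_big /=.
rewrite exchange_big /= mulr_sumr; apply: ler_sum => z oz.
under eq_bigr do rewrite -mulr_sumr -big_mkcondr /=.
rewrite -mulr_sumr.
apply: le_trans (ler_wpM2l _ (congestion z LK)) _.
  by rewrite mulr_ge0 ?local_energy_ge0 // exprn_ge0 // ler0n.
rewrite -/N (_ : kappa ^+ 4 * N ^+ 3 = N * (kappa ^+ 4 * N ^+ 2)); last by ring.
rewrite [in X in _ <= X]exprMn.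
by rewrite le_eqVlt; apply/orP/or_introl/eqP; ring.
Qed.

Lemma poincare k f : (0 < #|A|)%N -> layout [set: G] k ->
  \sum_(x : spin | valid x) \sum_(y : spin | valid y)
     weight x * weight y * (f x - f y) ^+ 2
  <= #|G|%:R ^+ 2 * (kappa ^+ 4 * #|A|%:R ^+ 3) ^+ (2 * k).+1 * partition_function *
     \sum_(z : spin | valid z) weight z * local_energy f z.
Proof.
move=> A0 [s [us sG bs]].
have szs : size s = #|G|.
  by rewrite -(card_uniqP us); apply: eq_card => v; rewrite sG !inE.
pose L i := [set x in take i s]; pose H i := boundary setT (L i).
(* [K i] holds the seams of two consecutive prefixes and the new vertex, hence the size 2k + 1;
   consecutive interpolants agree off it. *)
pose K i := H i :|: H i.+1 :|: (L i.+1 :\: L i).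
pose sigma i x y := extension (H i) (glue (L i) x y).
have sigP i x y : valid x -> valid y ->
    valid (sigma i x y) /\ agree_off (H i) (glue (L i) x y) (sigma i x y).
  by move=> ox oy; apply/andP; apply: extensionP.
(* The empty and the full prefix have empty boundary, so no repair takes place at the two ends of
   the walk. *)
have extE i x y z : L i = set0 \/ L i = setT -> glue (L i) x y = z ->
    valid x -> valid y -> sigma i x y = z.
  move=> Li <- ox oy; have [_ /agree_offP sx] := sigP i x y ox oy.
  apply/esym/ffunP => u; apply: sx; apply/negP => /boundaryP [].
  by case: Li => ->; rewrite ?inE // => _ [v]; rewrite !inE => -[].
have L0 : L 0%N = set0 by apply/setP => u; rewrite inE take0 in_set0.
have Ln : L #|G| = setT by apply/setP => u; rewrite !inE -szs take_size sG inE.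
have sig0 x y : valid x -> valid y -> sigma 0%N x y = x.
  by apply: extE; [left|apply/ffunP => u; rewrite ffunE L0 in_set0].
have sign x y : valid x -> valid y -> sigma #|G| x y = y.
  by apply: extE; [right|apply/ffunP => u; rewrite ffunE Ln in_setT].
have HK i : H i \subset K i by rewrite /K -setUA subsetUl.
have cardK i : (#|K i| <= (2 * k).+1)%N.
  have Ls : (#|L i.+1 :\: L i| <= 1)%N.
    have [si|si] := leqP (size s) i.
      by rewrite /L !take_oversize ?(leqW si) // setDv cards0.
    have [v0 _] : exists v0, v0 \in s.
      by case: (s) si => // v0 s' _; exists v0; rewrite mem_head.
    rewrite -(cards1 (nth v0 s i)).
    apply/subset_leq_card/subsetP => u; rewrite !inE (take_nth v0) // mem_rcons inE.
    by move=> /andP [/negPf ->]; rewrite orbF.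
  have [h1 h2] := (leq_card_setU (H i :|: H i.+1) (L i.+1 :\: L i), leq_card_setU (H i) (H i.+1)).
  have [h3 h4] : (#|H i| <= k /\ #|H i.+1| <= k)%N by split; apply: bs.
  rewrite /K; move: (h1 : (_ <= _)%N) (h2 : (_ <= _)%N); lia.
set M : R := kappa ^+ 4 * #|A|%:R ^+ 3.
(* This allows the exponent [#|K i|] to be raised to the uniform value 2k + 1. *)
have M1 : 1 <= M by rewrite -[1]mulr1 ler_pM // exprn_ege1 // ler1n.
set E := \sum_(z | _) _ * local_energy _ _.
have E0 : 0 <= E.
  by apply: sumr_ge0 => z _; rewrite mulr_ge0 ?local_energy_ge0 // ltW ?weight_gt0.
have Z0 : 0 <= partition_function by apply: sumr_ge0 => z _; rewrite ltW ?weight_gt0.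
have step i : \sum_(x : spin | valid x) \sum_(y : spin | valid y)
    weight x * weight y * (f (sigma i x y) - f (sigma i.+1 x y)) ^+ 2
    <= M ^+ (2 * k).+1 * partition_function * E.
  apply: le_trans (block_energy (K := K i) (L := L i) _ _ _) _; first exact: HK.
    move=> x y ox oy; have [o1 a1] := sigP i x y ox oy.
    have [o2 a2] := sigP i.+1 x y ox oy; split=> //; first exact: agree_offS (HK i) a1.
    apply: agree_off_trans (agree_offS _ a2).
      apply/agree_offP => u; rewrite /K !in_setU !negb_or => /andP [_].
      rewrite in_setD negb_and negbK !ffunE => /orP [uL|/negPf uL].
        rewrite uL; case: ifPn => // /negP []; move: uL; rewrite !inE.
        by move=> uL; rewrite -(cat_take_drop i (take i.+1 s)) take_takel // mem_cat uL.
      rewrite uL; case: ifPn => // uL'; move/negP: uL; case; move: uL'; rewrite !inE.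
      by move=> uL; rewrite -(cat_take_drop i (take i.+1 s)) take_takel // mem_cat uL.
    by rewrite /K setUAC subsetUr.
  by apply: ler_wpM2r => //; apply: ler_wpM2r => //; apply: ler_weXn2l.
(* Cauchy-Schwarz over the telescoping walk costs one factor [#|G|]; summing over its steps costs
   the other. *)
have tele x y : valid x -> valid y -> (f x - f y) ^+ 2 <=
    #|G|%:R * \sum_(i < #|G|) (f (sigma i x y) - f (sigma i.+1 x y)) ^+ 2.
  move=> ox oy; have := sumr_sq_le (index_enum 'I_#|G|) predT
    (fun i : 'I_#|G| => f (sigma i x y) - f (sigma i.+1 x y)).
  rewrite sumr_const card_ord -(big_mkord predT
    (fun i => f (sigma i x y) - f (sigma i.+1 x y))).
  rewrite -[X in X ^+ 2 <= _ -> _]opprK -sumrN sqrrN.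
  rewrite (eq_bigr (fun i => f (sigma i.+1 x y) - f (sigma i x y))); last first.
    by move=> i _; rewrite opprB.
  by rewrite telescope_sumr // sig0 // sign // -sqrrN opprB.
apply: (@le_trans _ _ (\sum_(i < #|G|) #|G|%:R * (M ^+ (2 * k).+1 * partition_function * E))).
  apply: (@le_trans _ _ (\sum_(x : spin | valid x) \sum_(y : spin | valid y)
      \sum_(i < #|G|) #|G|%:R *
        (weight x * weight y * (f (sigma i x y) - f (sigma i.+1 x y)) ^+ 2))).
    apply: ler_sum => x ox; apply: ler_sum => y oy.
    apply: le_trans (ler_wpM2l _ (tele x y ox oy)) _.
      by rewrite mulr_ge0 // ltW ?weight_gt0.
    by rewrite mulrCA !mulr_sumr.
  under eq_bigr do rewrite exchange_big /=.
  rewrite exchange_big; apply: ler_sum => i _ /=.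
  under eq_bigr do rewrite -mulr_sumr.
  by rewrite -mulr_sumr ler_wpM2l // ler0n.
by rewrite sumr_const card_ord -[X in X <= _]mulr_natl expr2 !mulrA.
Qed.

End Poincare.

(** * Mixing of single-site dynamics *)

(** As n is at least 2, powers of 2 are bounded by powers of n, and 2^m <= 2n <= n^2 handles the
    block factor. The exponents add up to 39M + 6 + 28Mt, at most (67M + 6)t. *)
Lemma time_bound_le n M t m : (1 < n)%N -> (0 < t)%N -> (2 ^ m <= 2 * n)%N ->
  (n ^ 3 * 2 ^ (3 * M) * 2 ^ (7 * M * (2 * (t.+1 * m)).+1) * (3 * M * n + 3)
   <= n ^ ((67 * M + 6) * t))%N.
Proof.
move=> n1 t0 mn; have n0 : (0 < n)%N by apply: ltnW.
have expl a b e : (a <= b -> a ^ e <= b ^ e)%N.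
  by case: e => // e ab; rewrite leq_exp2r.
have blocks : (2 ^ (7 * M * (2 * (t.+1 * m)).+1) <= n ^ (7 * M + 28 * M * t.+1))%N.
  rewrite (_ : (7 * M * _ = 7 * M + m * (14 * M * t.+1))%N); last by lia.
  rewrite (expnD 2 (7 * M)) (expnD n (7 * M)); apply: leq_mul; [exact: expl|rewrite expnM].
  apply: leq_trans (expl _ (n ^ 2)%N _ _) _; first by apply: leq_trans mn _; rewrite leq_mul.
  by rewrite -expnM leq_pexp2l //; lia.
have linear : (3 * M * n + 3 <= n ^ (M + 3))%N.
  apply: (@leq_trans (2 ^ (M + 2) * n)); last first.
    rewrite (_ : (M + 3 = (M + 2).+1)%N) ?expnS; last by lia.
    by rewrite mulnC leq_mul // expl.
  have : (M < 2 ^ M)%N by rewrite ltn_expl.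
  rewrite expnD -[(2 ^ 2)%N]/4%N; nia.
apply: leq_trans (_ : n ^ 3 * n ^ (3 * M) * n ^ (7 * M + 28 * M * t.+1) * n ^ (M + 3) <= _)%N.
  by rewrite !leq_mul // expl.
by rewrite -!expnD leq_pexp2l //; nia.
Qed.

(** With x = 1/N, Bernoulli gives (1 + x)^N >= 2, while (1 - x)^N (1 + x)^N <= 1. *)
Lemma half_power (R : realFieldType) (N : nat) : (0 < N)%N ->
  (1 - N%:R^-1) ^+ N <= 2^-1 :> R.
Proof.
move=> N0; set x : R := N%:R^-1.
have Nx : N%:R * x = 1 by rewrite mulfV // pnatr_eq0 -lt0n.
have x0 : 0 <= x by rewrite invr_ge0 ler0n.
have x1 : x <= 1 by rewrite invf_le1 ?ler1n ?ltr0n.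
have bern k : 1 + k%:R * x <= (1 + x) ^+ k.
  elim: k => [|k IHk]; first by rewrite mul0r addr0.
  rewrite exprS -natr1; apply: le_trans (ler_wpM2l _ IHk); last by rewrite addr_ge0.
  have : 0 <= k%:R * x * x by rewrite !mulr_ge0 ?ler0n.
  nra.
have := bern N; rewrite Nx => h2.
have h1 : (1 - x) ^+ N * (1 + x) ^+ N <= 1.
  by rewrite -exprMn exprn_ile1 //; nra.
have h0 : 0 <= (1 - x) ^+ N by rewrite exprn_ge0 // subr_ge0.
nra.
Qed.

Lemma big_sub_pred (R : nmodType) (T : finType) (Q : pred T) (h : T -> R) :
  \sum_(x : {x : T | Q x}) h (val x) = \sum_(x | Q x) h x.
Proof.
rewrite (reindex_omap (val : {x | Q x} -> T) insub) /=; last by move=> x Qx; rewrite insubT.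
by apply: eq_bigl => x; rewrite valK (valP x) eqxx.
Qed.

(** * Single-site chains on a general spin system *)

Section SpinChain.
Variables (R : realType) (G : sgraph) (A : finType) (compat : rel A).
Variables (w : A -> R) (valid : pred {ffun G -> A}) (M t : nat) (s : R).
Local Notation state := {x : {ffun G -> A} | valid x}.
Variable P : state -> state -> R.
Hypothesis validE : valid =1 compatible_on compat setT.
Hypothesis compat_sym : symmetric compat.
Hypothesis free_color : forall (v : G) (x : {ffun G -> A}) c,
  exists2 d, compat d c & forall u, sedge v u -> compat d (x u).
(** A single exponent [M] controls the alphabet size, the weights, the holding probability and the
    move rate, so that all constants become powers of 2. *)
Hypotheses (A_gt0 : (0 < #|A|)%N) (A_le : (#|A| <= 2 ^ M)%N).
Hypothesis w_bounds : forall a, (2 ^+ M)^-1 <= w a <= 2 ^+ M.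
Hypothesis P_sum1 : forall x, \sum_y P x y = 1.
Hypothesis P_lazy : forall x, (2 ^+ M)^-1 <= P x x.
(** For distinct states at most one [v] occurs in the sum; the sum avoids naming it and is 0 when
    the states differ at several vertices. *)
Hypothesis P_moves : forall x y, x != y ->
  P x y = s * \sum_(v | agree_off [set v] (val x) (val y)) w (val y v).
Hypothesis s_ge : (#|G|%:R * 2 ^+ M)^-1 <= s.
Hypotheses (t_gt0 : (0 < t)%N) (G_gt1 : (1 < #|G|)%N) (tw : treewidth_le G t).

Let kappa : R := 2 ^+ M.
Let n : R := #|G|%:R.
Let Z : R := partition_function G compat w.

Local Lemma pow2_ge1 : 1 <= kappa. Proof. by rewrite exprn_ege1 // ler1n. Qed.

Local Lemma n_gt0 : 0 < n. Proof. by rewrite ltr0n ltnW. Qed.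

Local Lemma s_gt0 : 0 < s.
Proof.
apply: lt_le_trans s_ge; rewrite invr_gt0 mulr_gt0 ?n_gt0 //.
exact: lt_le_trans ltr01 pow2_ge1.
Qed.

Lemma chain_ge0 x y : 0 <= P x y.
Proof.
have w0 a := w_gt0 pow2_ge1 w_bounds a.
have [<-|xy] := eqVneq x y.
  by apply: le_trans (P_lazy x); rewrite invr_ge0 exprn_ge0.
rewrite P_moves //; apply: mulr_ge0; first exact: ltW s_gt0.
by apply: sumr_ge0 => v _; apply: ltW.
Qed.

(** The two weights differ only in the factor at [v], and each transition probability supplies the
    factor of its target. *)
Lemma chain_detailed_balance x y :
  weight w (val x) * P x y = weight w (val y) * P y x.
Proof.
have [->//|xy] := eqVneq x y.
rewrite (P_moves xy) (P_moves (y := x)) 1?eq_sym // mulrCA [RHS]mulrCA; congr (_ * _).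
rewrite !mulr_sumr; apply: eq_big => [v|v xyv]; first by rewrite agree_offC.
rewrite /weight (bigD1 v) //= [in RHS](bigD1 v) //=.
rewrite (eq_bigr (fun u => w (val y u))); first by ring.
by move=> u uv; rewrite (agree_offP _ _ _ xyv) // inE.
Qed.

(** Every single-site move between distinct states has probability at least 1 / (n kappa^2): [s_ge]
    gives one factor kappa and the weight of the new color the other. *)
Lemma chain_local_energy (f : {ffun G -> A} -> R) (x : state) :
  local_energy compat f (val x) <=
    n * kappa ^+ 2 * \sum_y P x y * (f (val x) - f (val y)) ^+ 2.
Proof.
rewrite /local_energy (eq_bigl (fun y => valid y && single_site (val x) y)); last first.
  by move=> y; rewrite validE.
rewrite big_mkcondr /= -(big_sub_pred valid (fun y => if single_site (val x) y
  then (f (val x) - f y) ^+ 2 else 0)) mulr_sumr; apply: ler_sum => y _.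
have c0 : 0 <= n * kappa ^+ 2 by rewrite mulr_ge0 ?exprn_ge0 ?ler0n.
case: ifP => [/existsP [v xyv]|_]; last first.
  by apply: mulr_ge0 => //; apply: mulr_ge0; rewrite ?chain_ge0 ?sqr_ge0.
have [->|xy] := eqVneq x y; first by rewrite subrr expr0n !mulr0.
rewrite mulrA -[X in X <= _]mul1r ler_wpM2r ?sqr_ge0 //.
rewrite P_moves // (bigD1 v) //= mulrDr mulrDr -[1]addr0; apply: lerD; last first.
  apply: mulr_ge0 => //; apply: mulr_ge0; first exact: ltW s_gt0.
  by apply: sumr_ge0 => u _; rewrite ltW // (w_gt0 pow2_ge1 w_bounds).
have k0 : 0 < kappa := lt_le_trans ltr01 pow2_ge1.
have n0 := n_gt0.
have h : (n * kappa ^+ 2)^-1 <= s * w (val y v).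
  rewrite expr2 (mulrA n) [X in X <= _]invfM.
  by case/andP: (w_bounds (val y v)) => h _; apply: ler_pM => //; rewrite ltW // invr_gt0 ?mulr_gt0.
by rewrite -ler_pdivrMl ?mulr_gt0 ?exprn_gt0 // mulr1.
Qed.

Local Lemma some_valid : exists x, valid x.
Proof.
have [a _] : exists a : A, a \in A by case/card_gt0P: A_gt0 => a _; exists a.
have [|x] := @compatible_extension _ _ _ compat_sym free_color setT [ffun=> a].
  by apply/compatible_onP => u v _; rewrite !inE.
by case/andP => ox _; exists x; rewrite validE.
Qed.

Local Lemma Z_gt0 : 0 < Z.
Proof.
have [x]:= some_valid; rewrite validE => ox; rewrite /Z /partition_function (bigD1 x) //=.
have w0 y := weight_gt0 pow2_ge1 w_bounds y.
by rewrite ltr_pwDl // sumr_ge0 // => y _; apply: ltW.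
Qed.

Let pi : {ffun state -> R} := [ffun x => weight w (val x) / Z].

Local Lemma pi_gt0 x : 0 < pi x.
Proof. by rewrite ffunE divr_gt0 ?Z_gt0 // (weight_gt0 pow2_ge1 w_bounds). Qed.

Local Lemma sum_state (h : {ffun G -> A} -> R) :
  \sum_(x : state) h (val x) = \sum_(x | compatible_on compat setT x) h x.
Proof. by rewrite big_sub_pred; apply: eq_bigl. Qed.

Local Lemma pi_sum1 : \sum_x pi x = 1.
Proof.
under eq_bigr do rewrite ffunE.
rewrite -mulr_suml sum_state -/(partition_function _ _ _) mulfV //.
by rewrite gt_eqF // Z_gt0.
Qed.

(** Each weight is at least kappa^-n, and [Z] is at most [#|A|]^n kappa^n <= kappa^(2n). *)
Local Lemma pi_inv_le x : (pi x)^-1 <= 2 ^+ (3 * M * #|G|).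
Proof.
have k0 : 0 < kappa := lt_le_trans ltr01 pow2_ge1.
have prodE (c : R) : c ^+ #|G| = \prod_(v : G) c.
  by rewrite -prodr_const; apply: eq_bigl => v; rewrite inE.
have lb (y : {ffun G -> A}) : kappa ^- #|G| <= weight w y.
  rewrite -exprVn prodE /weight; apply: ler_prod => v _.
  by rewrite invr_ge0 ltW //=; case/andP: (w_bounds (y v)).
have ub (y : {ffun G -> A}) : weight w y <= kappa ^+ #|G|.
  rewrite prodE /weight; apply: ler_prod => v _.
  by case/andP: (w_bounds (y v)) => h ->; rewrite (le_trans _ h) // invr_ge0 ltW.
have Zub : Z <= kappa ^+ #|G| * kappa ^+ #|G|.
  apply: (@le_trans _ _ (\sum_(y : {ffun G -> A}) kappa ^+ #|G|)).
    rewrite /Z /partition_function big_mkcond; apply: ler_sum => y _.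
    by case: ifP => // _; rewrite exprn_ge0 // ltW.
  rewrite sumr_const card_ffun -mulr_natr natrX.
  apply: ler_wpM2l; first by rewrite exprn_ge0 // ltW.
  by apply: lerXn2r; rewrite ?nnegrE ?ler0n ?(ltW k0) // /kappa -natrX ler_nat.
rewrite ffunE invf_div.
have -> : 2 ^+ (3 * M * #|G|) = kappa ^+ #|G| * kappa ^+ #|G| * kappa ^+ #|G|.
  by rewrite /kappa -!exprM -!exprD; congr (_ ^+ _); lia.
have wx := weight_gt0 pow2_ge1 w_bounds (val x).
apply: ler_pM => //; rewrite ?invr_ge0 ?(ltW wx) ?(ltW Z_gt0) //.
rewrite -[X in _ <= X]invrK lef_pV2 ?lb // posrE ?invr_gt0 ?exprn_gt0 //.
Qed.

Theorem spin_mixing_time :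
  exists tau, is_mixing_time P (1 / 4) tau /\ (tau <= #|G| ^ ((67 * M + 6) * t))%N.
Proof.
pose m := (trunc_log 2 #|G|).+1.
have /andP [m1 m2] : (2 ^ m.-1 <= #|G| < 2 ^ m)%N by apply: trunc_log_bounds; lia.
have lay : layout [set: G] (t.+1 * m) by apply: layout_treewidth tw _; rewrite cardsT.
set k := (t.+1 * m)%N in lay.
(* [B] dominates the block constant of the Poincare inequality: [#|A|] is at most [kappa], and 4 + 3
   = 7. *)
pose B := (2 ^ (7 * M * (2 * k).+1))%N.
(* The inverse gap: n^2 B comes from [poincare], n kappa^2 from [chain_local_energy], and a last
   kappa from the holding probability. *)
pose N := (#|G| ^ 3 * 2 ^ (3 * M) * B)%N.
have N0 : (0 < N)%N by rewrite !muln_gt0 !expn_gt0 ltnW.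
have k0 : 0 < kappa := lt_le_trans ltr01 pow2_ge1.
(* Every [N] steps halve the variance bound; 3Mn halvings absorb 1 / pi x, and three more reach
   1/8. *)
pose T := (N * (3 * M * #|G| + 3))%N.
have Nr0 : 0 < N%:R :> R by rewrite ltr0n.
have g1 : N%:R^-1 <= 1 :> R by rewrite invf_le1 // ler1n.
have [||||tau [mt tauT]] := @mixing_time_le R _ P pi kappa^-1 N%:R^-1
  chain_ge0 P_sum1 pi_gt0 pi_sum1 _ P_lazy g1 _ T.
- by move=> x y; rewrite !ffunE mulrAC chain_detailed_balance mulrAC.
- move=> f f0.
  set D := \sum_x _ * \sum_y _; set V := \sum_x _.
  pose f' x := oapp f 0 (insub x).
  have f'E (x : state) : f' (val x) = f x by rewrite /f' valK.
  have Z0 := Z_gt0; have ZN0 : Z != 0 by rewrite gt_eqF.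
  have piE (x : state) : weight w (val x) = Z * pi x.
    by rewrite ffunE mulrC divfK.
  have D0 : 0 <= D.
    apply: sumr_ge0 => x _; apply: mulr_ge0; first exact: ltW (pi_gt0 x).
    by apply: sumr_ge0 => y _; rewrite mulr_ge0 ?sqr_ge0 // chain_ge0.
  have := poincare compat_sym free_color pow2_ge1 w_bounds f' A_gt0 lay.
  rewrite -!sum_state -/n -/Z.
  (* For a mean-zero function the double sum of squared differences is twice the variance. *)
  have -> : \sum_(x : state) \sum_(y | compatible_on compat setT y)
      weight w (val x) * weight w y * (f' (val x) - f' y) ^+ 2 = Z ^+ 2 * (2 * V).
    transitivity (\sum_(x : state) Z ^+ 2 * (pi x * f x ^+ 2 + pi x * V)); last first.
      by rewrite -mulr_sumr big_split /= -mulr_suml pi_sum1 mul1r -/V; ring.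
    apply: eq_bigr => x _; rewrite -sum_state.
    transitivity (\sum_(y : state) (Z ^+ 2 * (pi x * f x ^+ 2) * pi y
        - 2 * Z ^+ 2 * pi x * f x * (pi y * f y) + Z ^+ 2 * pi x * (pi y * f y ^+ 2))).
      by apply: eq_bigr => y _; rewrite !f'E !piE; ring.
    by rewrite big_split sumrB /= -!mulr_sumr f0 pi_sum1 -/V; ring.
  have energy : \sum_(x : state) weight w (val x) * local_energy compat f' (val x) <=
      Z * (n * kappa ^+ 2) * D.
    rewrite mulr_sumr; apply: ler_sum => x _.
    apply: le_trans (ler_wpM2l _ (chain_local_energy f' x)) _.
      exact: ltW (weight_gt0 pow2_ge1 w_bounds _).
    under eq_bigr do rewrite !f'E.
    by rewrite piE le_eqVlt; apply/orP/or_introl/eqP; ring.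
  set q : R := (kappa ^+ 4 * _) ^+ _ => poin.
  have qB : q <= B%:R.
    rewrite /B (_ : (7 * M * _ = M * 7 * (2 * k).+1)%N); last by lia.
    rewrite natrX exprM; apply: lerXn2r.
    - by rewrite nnegrE mulr_ge0 ?exprn_ge0 ?ler0n // ltW.
    - by rewrite nnegrE exprn_ge0.
    rewrite exprM -/kappa (exprD kappa 4 3) ler_wpM2l ?exprn_ge0 ?(ltW k0) //.
    by apply: lerXn2r; rewrite ?nnegrE ?ler0n ?(ltW k0) // /kappa -natrX ler_nat.
  have q0 : 0 <= q by rewrite exprn_ge0 // mulr_ge0 ?exprn_ge0 ?ler0n // ltW.
  have NE : N%:R = n ^+ 3 * kappa ^+ 3 * B%:R.
    by rewrite /N !natrM natrX natrX mulnC exprM.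
  have n0 := n_gt0.
  have V2 : 2 * V <= n ^+ 3 * kappa ^+ 2 * q * D.
    rewrite -(ler_pM2l (exprn_gt0 2 Z0)); apply: le_trans poin _.
    apply: le_trans (ler_wpM2l _ energy) _.
      by apply: mulr_ge0 (ltW Z0); apply: mulr_ge0 q0; rewrite exprn_ge0 // ltW.
    by rewrite le_eqVlt; apply/orP/or_introl/eqP; ring.
  have V0 : 0 <= V.
    by apply: sumr_ge0 => x _; rewrite mulr_ge0 ?sqr_ge0 // (ltW (pi_gt0 x)).
  have V3 : V <= n ^+ 3 * kappa ^+ 2 * B%:R * D.
    apply: (@le_trans _ _ (2 * V)); first by lra.
    apply: le_trans V2 _; apply: ler_wpM2r => //; apply: ler_wpM2l => //.
    by rewrite mulr_ge0 ?exprn_ge0 ?(ltW k0) ?(ltW n0).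
  rewrite ler_pdivrMl // NE; apply: le_trans V3 _.
  rewrite le_eqVlt; apply/orP/or_introl/eqP; field.
  by rewrite gt_eqF.
- by rewrite invr_gt0.
- move=> x; rewrite /T exprM.
  have h0 : 0 <= (1 - N%:R^-1) ^+ N :> R by rewrite exprn_ge0 // subr_ge0.
  have h1 : ((1 - N%:R^-1) ^+ N) ^+ (3 * M * #|G| + 3) <= 2^-1 ^+ (3 * M * #|G| + 3) :> R.
    by apply: lerXn2r; rewrite ?nnegrE ?invr_ge0 ?half_power.
  have p0 := pi_gt0 x.
  have p1 : 0 <= (pi x)^-1 by rewrite invr_ge0 ltW.
  apply: le_lt_trans (ler_pM (exprn_ge0 _ h0) p1 h1 (pi_inv_le x)) _.
  move: (3 * M * #|G|)%N => e.
  by rewrite exprD mulrAC -exprMn mulVf ?expr1n ?pnatr_eq0 //; lra.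
exists tau; split=> //; apply: leq_trans tauT _.
apply: time_bound_le => //.
by rewrite /m expnS leq_mul.
Qed.

End SpinChain.

(** * Colorings and partial colorings *)

Lemma mean_const (R : numFieldType) (T : finType) (Q : pred T) (c : R) :
  (0 < #|Q|)%N -> \sum_(i | Q i) #|Q|%:R^-1 * c = c.
Proof.
move=> Q0; rewrite sumr_const -[X in X = _]mulr_natl mulrA mulfV ?mul1r //.
by rewrite pnatr_eq0 -lt0n.
Qed.

Lemma sum_point (R : pzRingType) (T : finType) (Q : pred T) (z : T) :
  Q z -> \sum_(y : {y : T | Q y}) (val y == z)%:R = 1 :> R.
Proof.
move=> Qz; rewrite (bigD1 (exist _ z Qz)) //= eqxx big1 ?addr0 // => y yz.
case: eqP => // yE; case/negP: yz; apply/eqP/val_inj; exact: yE.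
Qed.

Lemma sum_indicator (R : pzRingType) (T : finType) (z : T) :
  \sum_y (y == z)%:R = 1 :> R.
Proof. by rewrite (bigD1 z) //= eqxx big1 ?addr0 // => y /negPf ->. Qed.

Lemma eq_recolor (G : sgraph) (A : finType) (x y : {ffun G -> A}) v c :
  (y == recolor x v c) = agree_off [set v] x y && (y v == c).
Proof.
apply/eqP/andP => [->|[/agree_offP xy /eqP <-]].
  by rewrite agree_off_recolor ffunE eqxx.
by apply/ffunP => u; rewrite ffunE; case: eqVneq => [->//|uv]; rewrite xy // inE.
Qed.

Lemma agree_off_neq (G : sgraph) (A : finType) (x y : {ffun G -> A}) v :
  x != y -> agree_off [set v] x y -> x v != y v.
Proof.
move=> xy /agree_offP xyv; apply: contraNneq xy => xyE; apply/eqP/ffunP => u.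
by have [->//|uv] := eqVneq u v; rewrite xyv // inE.
Qed.

(** * Glauber dynamics on proper colorings *)

Section ProperColorings.
Variables (R : realType) (G : sgraph) (q : nat).
Hypotheses (q_gt1 : (1 < q)%N) (G_gt0 : (0 < #|G|)%N).
Local Notation neq_color := (fun a b : 'I_q => a != b).
Implicit Types x y : coloring G q.

Lemma is_properE : @is_proper G q =1 compatible_on neq_color setT.
Proof.
by move=> x; apply: eq_forallb => u; apply: eq_forallb => v; rewrite !inE !andbT.
Qed.

Lemma is_proper_recolor x v (c : 'I_q) :
  [forall u, sedge v u ==> (val x u != c)] -> is_proper (recolor (val x) v c).
Proof.
move=> /forallP h; rewrite is_properE; apply: compatible_on_recolor.
- by move=> a b; rewrite eq_sym.
- by apply: compatible_onS (subsetT _) _; rewrite -is_properE (valP x).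
by move=> u vu; rewrite eq_sym; exact: implyP (h u) vu.
Qed.

Lemma glauber_move_sum x v c : \sum_y glauber_move R x v c y = 1.
Proof.
rewrite /glauber_move; case: (boolP [forall u, _]) => [ok|_].
  rewrite big_split /= -!mulr_sumr (sum_point R (is_proper_recolor ok)) sum_indicator; lra.
exact: sum_indicator.
Qed.

Lemma card_other_colors (a : 'I_q) : #|[pred c | c != a]|%:R = q%:R - 1 :> R.
Proof.
rewrite (_ : #|_| = q.-1); last by rewrite -[in RHS](card_ord q) (cardC1 a).
by rewrite -subn1 natrB // ltnW.
Qed.

Lemma mean_other_colors (a : 'I_q) (c : R) :
  \sum_(b | b != a) (q%:R - 1)^-1 * c = c.
Proof.
rewrite -(card_other_colors a); apply: (@mean_const R _ [pred b | b != a]).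
by rewrite -(ltr0n R) card_other_colors subr_gt0 ltr1n.
Qed.

Lemma mean_vertices (c : R) : \sum_(v : G) #|G|%:R^-1 * c = c.
Proof. exact: (@mean_const R G predT). Qed.

Lemma glauber_sum x : \sum_y glauber R x y = 1.
Proof.
rewrite -[RHS]mean_vertices exchange_big; apply: eq_bigr => v _ /=.
rewrite -mulr_sumr; congr (_ * _); rewrite exchange_big /=.
rewrite -[RHS](mean_other_colors (val x v)); apply: eq_bigr => c _.
by rewrite -mulr_sumr glauber_move_sum.
Qed.

(** Even an admissible proposal is declined with probability 1/2. *)
Lemma glauber_lazy x : 2^-1 <= glauber R x x.
Proof.
rewrite -[X in X <= _]mean_vertices; apply: ler_sum => v _.
rewrite ler_wpM2l ?invr_ge0 ?ler0n // -[X in X <= _](mean_other_colors (val x v)).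
apply: ler_sum => c _; rewrite ler_wpM2l ?invr_ge0 ?subr_ge0 ?ler1n ?(ltnW q_gt1) //.
rewrite /glauber_move eqxx; case: ifP => _ /=; last by lra.
by case: (_ == _) => /=; lra.
Qed.

(** This puts the chain in the form [P_moves] with constant weight 1: only the proposal of the color
    [val y v] at [v] leads to [y]. *)
Lemma glauber_neq x y : x != y -> glauber R x y =
  (#|G|%:R * (2 * (q%:R - 1)))^-1 * \sum_(v | agree_off [set v] (val x) (val y)) 1.
Proof.
move=> xy; have vxy : val x != val y by rewrite (inj_eq val_inj).
have q1 : q%:R - 1 != 0 :> R by rewrite gt_eqF // subr_gt0 ltr1n.
have n0 : #|G|%:R != 0 :> R by rewrite pnatr_eq0 -lt0n.
rewrite /glauber mulr_sumr [RHS]big_mkcond; apply: eq_bigr => v _ /=.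
rewrite /glauber_move eq_sym (negPf xy).
case: ifP => xyv; last first.
  rewrite big1 ?mulr0 // => c _; rewrite eq_recolor xyv /= !mulr0 addr0.
  by case: ifP; rewrite mulr0.
have xv : val y v != val x v by rewrite eq_sym agree_off_neq.
rewrite (bigD1 (val y v)) //= [X in _ + X]big1 ?addr0 => [|c /andP [_ cv]]; last first.
  rewrite eq_recolor xyv [val y v == c]eq_sym (negPf cv) /= !mulr0 addr0.
  by case: ifP; rewrite mulr0.
rewrite eq_recolor xyv eqxx /= mulr0 addr0.
(* The proposed color is admissible because [x] and [y] agree at the neighbors of [v] and [y] is
   proper. *)
rewrite ifT; first by field; rewrite q1 n0.
apply/forallP => u; apply/implyP => vu.
have uv : u != v by apply: contraTneq vu => ->; rewrite sedge_irrefl.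
rewrite (agree_offP _ _ _ xyv) ?inE //; have := valP y; rewrite is_properE.
by move/compatible_onP; apply; rewrite ?inE // sedge_sym.
Qed.

Lemma glauber_mixing_time t : (max_degree G + 2 <= q)%N -> (0 < t)%N ->
    (1 < #|G|)%N -> treewidth_le G t ->
  exists tau, is_mixing_time (@glauber R G q) (1 / 4) tau /\
    (tau <= #|G| ^ ((67 * q.+1 + 6) * t))%N.
Proof.
move=> dq t0 G1 tw.
have twoq : (2 * q <= 2 ^ q.+1)%N by rewrite expnS leq_mul // ltnW // ltn_expl.
have k1 : 1 <= 2 ^+ q.+1 :> R by rewrite exprn_ege1 // ler1n.
have k0 : 0 < 2 ^+ q.+1 :> R := lt_le_trans ltr01 k1.
apply: (@spin_mixing_time R G 'I_q neq_color (fun=> 1) (@is_proper G q) q.+1 t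
  (#|G|%:R * (2 * (q%:R - 1)))^-1) => //.
- exact: is_properE.
- by move=> a b; rewrite eq_sym.
(* The neighbors of [v] and [c] exclude at most Delta + 1 colors, fewer than [q]. *)
- move=> v x c; pose used := c |: [set x u | u in [set u | sedge v u]].
  have : (#|used| < #|'I_q|)%N.
    rewrite card_ord; apply: leq_trans dq; rewrite addn2 ltnS.
    apply: leq_trans (leq_card_setU _ _) _; rewrite cards1 add1n ltnS.
    apply: leq_trans (leq_imset_card _ _) _.
    exact: (@leq_bigmax _ (@degree G) v).
  move=> used_lt; have /subsetPn [d _] : ~~ ([set: 'I_q] \subset used).
    by apply: contraL used_lt => /subset_leq_card; rewrite cardsT -leqNgt.
  rewrite !inE negb_or => /andP [dc dN]; exists d => // u vu.
  by apply: contraNneq dN => ->; apply: imset_f; rewrite inE.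
- by rewrite card_ord ltnW.
- by rewrite card_ord; lia.
- by move=> _; rewrite k1 andbT invf_le1.
- exact: glauber_sum.
- move=> x; apply: le_trans (glauber_lazy x).
  by rewrite lef_pV2 ?posrE // exprS ler_peMr // exprn_ege1 // ler1n.
- exact: glauber_neq.
- have q1 : 0 < q%:R - 1 :> R by rewrite subr_gt0 ltr1n.
  have n0 : 0 < #|G|%:R :> R by rewrite ltr0n.
  rewrite lef_pV2 ?posrE ?mulr_gt0 // ler_pM2l //.
  by rewrite (@le_trans _ _ (2 * q)%:R) // ?natrM ?ler_pM2l ?gerBl // -natrM -natrX ler_nat.
Qed.

End ProperColorings.

(** * Glauber dynamics on partial colorings *)

Section PartialColorings.
Variables (R : realType) (G : sgraph) (q : nat) (lambda : R).
Hypotheses (lambda_gt0 : 0 < lambda) (G_gt0 : (0 < #|G|)%N).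
Implicit Types x y : partial_coloring G q.

Definition partial_compat : rel (option 'I_q) :=
  [rel a b | isSome a && isSome b ==> (a != b)].

Definition partial_weight (a : option 'I_q) : R := if a is Some _ then lambda else 1.

Lemma is_partial_properE :
  @is_partial_proper G q =1 compatible_on partial_compat setT.
Proof.
move=> x; apply: eq_forallb => u; apply: eq_forallb => v; rewrite !inE !andbT.
by rewrite /partial_compat /=; case: (sedge u v).
Qed.

Lemma partial_move_sum x v c : \sum_y partial_glauber_move lambda x v c y = 1.
Proof.
rewrite /partial_glauber_move; case: (boolP (_ && _)) => [/andP [_ ok]|_]; last exact: sum_indicator.
by rewrite big_split /= -!mulr_sumr (sum_point R ok) sum_indicator !mulr1 addrC subrK.
Qed.

Lemma mean_choices (c : R) : \sum_(a : option 'I_q) q.+1%:R^-1 * c = c.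
Proof.
have := @mean_const R (option 'I_q) predT c; rewrite card_option card_ord; exact.
Qed.

Lemma partial_glauber_sum x : \sum_y partial_glauber lambda x y = 1.
Proof.
rewrite -[RHS](mean_vertices G_gt0) exchange_big; apply: eq_bigr => v _ /=.
rewrite -mulr_sumr; congr (_ * _); rewrite exchange_big /=.
rewrite -[RHS]mean_choices; apply: eq_bigr => c _.
by rewrite -mulr_sumr partial_move_sum.
Qed.

Lemma partial_probability (c : option 'I_q) :
  (if c is Some _ then lambda / (lambda + 1) else 1 / (lambda + 1)) =
  partial_weight c / (lambda + 1).
Proof. by case: c. Qed.

Lemma partial_move_ge0 x v c y : 0 <= partial_glauber_move lambda x v c y.
Proof.
rewrite /partial_glauber_move partial_probability; case: ifP => _; last exact: ler0n.
have l1 : 0 < lambda + 1 by rewrite addr_gt0.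
have w0 : 0 <= partial_weight c / (lambda + 1).
  by rewrite divr_ge0 ?(ltW l1) // /partial_weight; case: (c) => *; rewrite ?ler01 ?(ltW lambda_gt0).
have w1 : partial_weight c / (lambda + 1) <= 1.
  by rewrite ler_pdivrMr // mul1r /partial_weight; case: (c) => [_|]; rewrite ?lerDl ?lerDr ?(ltW lambda_gt0).
by rewrite addr_ge0 // mulr_ge0 ?ler0n ?subr_ge0.
Qed.

(** Proposing at [v] the value it already has leaves the state fixed. *)
Lemma partial_glauber_lazy x : q.+1%:R^-1 <= partial_glauber lambda x x.
Proof.
rewrite -[X in X <= _](mean_vertices G_gt0); apply: ler_sum => v _.
rewrite ler_wpM2l ?invr_ge0 ?ler0n // (bigD1 (val x v)) //=.
rewrite {1}/partial_glauber_move eqxx /= eqxx mulr1 lerDl.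
by apply: sumr_ge0 => c _; rewrite mulr_ge0 ?invr_ge0 ?ler0n ?partial_move_ge0.
Qed.

(** Coloring and uncoloring are both accepted with probability weight / (lambda + 1), which gives
    the form [P_moves] for [partial_weight]. *)
Lemma partial_glauber_neq x y : x != y -> partial_glauber lambda x y =
  (#|G|%:R * (q.+1%:R * (lambda + 1)))^-1 *
    \sum_(v | agree_off [set v] (val x) (val y)) partial_weight (val y v).
Proof.
move=> xy; have vxy : val x != val y by rewrite (inj_eq val_inj).
have q1 : q.+1%:R != 0 :> R by rewrite pnatr_eq0.
have n0 : #|G|%:R != 0 :> R by rewrite pnatr_eq0 -lt0n.
have l1 : lambda + 1 != 0 by rewrite gt_eqF // addr_gt0.
rewrite /partial_glauber mulr_sumr [RHS]big_mkcond; apply: eq_bigr => v _ /=.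
rewrite /partial_glauber_move [y == x]eq_sym (negPf xy).
case: ifP => xyv; last first.
  rewrite big1 ?mulr0 // => c _; rewrite eq_recolor xyv /= !mulr0 addr0.
  by case: ifP; rewrite mulr0.
rewrite (bigD1 (val y v)) //= [X in _ + X]big1 ?addr0 => [|c cv]; last first.
  rewrite eq_recolor xyv [val y v == c]eq_sym (negPf cv) /= !mulr0 addr0.
  by case: ifP; rewrite mulr0.
have yE : recolor (val x) v (val y v) = val y.
  by apply/esym/eqP; rewrite eq_recolor xyv eqxx.
rewrite yE (valP y) eqxx agree_off_neq //= partial_probability mulr0 addr0.
move: (q.+1%:R) q1 => Q q1.
by field; rewrite q1 n0 l1.
Qed.

Lemma partial_glauber_mixing_time M t :
    q.+1%:R * (lambda + 1) <= 2 ^+ M -> lambda^-1 <= 2 ^+ M -> (0 < t)%N ->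
    (1 < #|G|)%N -> treewidth_le G t ->
  exists tau, is_mixing_time (@partial_glauber R G q lambda) (1 / 4) tau /\
    (tau <= #|G| ^ ((67 * M + 6) * t))%N.
Proof.
move=> M1 M2 t0 G1 tw.
have k1 : 1 <= 2 ^+ M :> R by rewrite exprn_ege1 // ler1n.
have k0 : 0 < 2 ^+ M :> R := lt_le_trans ltr01 k1.
have q0 : 0 < q.+1%:R :> R by rewrite ltr0n.
have l1 : 0 < lambda + 1 by rewrite addr_gt0.
have qM : q.+1%:R <= 2 ^+ M :> R.
  by apply: le_trans M1; rewrite ler_peMr ?(ltW q0) // lerDr ltW.
apply: (@spin_mixing_time R G _ partial_compat partial_weight
  (@is_partial_proper G q) M t (#|G|%:R * (q.+1%:R * (lambda + 1)))^-1) => //.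
- exact: is_partial_properE.
- by move=> a b; rewrite /partial_compat /= andbC eq_sym.
- by move=> v x c; exists None.
- by rewrite card_option.
- by rewrite card_option card_ord -(ler_nat R) natrX.
- move=> a; rewrite /partial_weight; case: a => [_|]; last by rewrite k1 andbT invf_le1.
  rewrite -[X in _ <= X <= _]invrK lef_pV2 ?posrE ?invr_gt0 // M2 /= invrK.
  apply: le_trans M1; apply: (@le_trans _ _ (lambda + 1)); first by rewrite lerDl.
  by rewrite ler_peMl ?(ltW l1) // ler1n.
- exact: partial_glauber_sum.
- move=> x; apply: le_trans (partial_glauber_lazy x).
  by rewrite lef_pV2 ?posrE.
- exact: partial_glauber_neq.
- have n0 : 0 < #|G|%:R :> R by rewrite ltr0n.
  by rewrite lef_pV2 ?posrE ?mulr_gt0 // ler_pM2l.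
Qed.

End PartialColorings.

Theorem theorem2 (R : realType) :
  (forall Delta q : nat, (1 <= Delta)%N -> (Delta + 2 <= q)%N ->
    exists C : R, 0 < C /\
      forall (t : nat) (G : sgraph), (1 <= t)%N -> (2 <= #|G|)%N ->
        (max_degree G <= Delta)%N -> treewidth_le G t ->
        exists tau : nat, is_mixing_time (@glauber R G q) (1 / 4) tau /\
          tau%:R <= #|G|%:R `^ (C * t%:R))
  /\
  (forall (lambda : R) (q : nat), 0 < lambda ->
    exists C : R, 0 < C /\
      forall (t : nat) (G : sgraph), (1 <= t)%N -> (2 <= #|G|)%N ->
        treewidth_le G t -> (max_degree G + 2 <= q)%N ->
        exists tau : nat,
          is_mixing_time (@partial_glauber R G q lambda) (1 / 4) tau /\
          tau%:R <= #|G|%:R `^ (C * t%:R)).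
Proof.
have pow n C t tau : (tau <= n ^ (C * t))%N -> tau%:R <= n%:R `^ (C%:R * t%:R) :> R.
  by rewrite -natrM powR_mulrn ?ler0n // -natrX ler_nat.
split=> [Delta q D1 Dq|lambda q l0].
  exists (67 * q.+1 + 6)%:R; split; first by rewrite ltr0n addn_gt0 orbT.
  move=> t G t1 G2 GD tw.
  have [|||tau [mt le]] := @glauber_mixing_time R G q _ _ t _ t1 G2 tw.
  - lia.
  - lia.
  - lia.
  by exists tau; split=> //; apply: pow.
(* This provides an [M], depending only on [q] and [lambda], with 2^M above both (q + 1)(lambda + 1)
   and 1 / lambda. *)
have := upper_nthrootP (leqnn (Num.bound (q.+1%:R * (lambda + 1) + lambda^-1))).
move: (Num.bound _) => M hM.
exists (67 * M + 6)%:R; split; first by rewrite ltr0n addn_gt0 orbT.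
move=> t G t1 G2 tw _.
have p1 : 0 < q.+1%:R * (lambda + 1) by rewrite mulr_gt0 ?ltr0n // addr_gt0.
have p2 : 0 < lambda^-1 by rewrite invr_gt0.
have [|||tau [mt le]] := @partial_glauber_mixing_time R G q lambda l0 _ M t _ _ t1 G2 tw.
- exact: ltnW.
- lra.
- lra.
by exists tau; split=> //; apply: pow.
Qed.
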